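(* Let $K$ be an infinite field and $\mathsf{M}$ a loopless matroid on $[n]$ with $k$ connected components, $E=K\langle e_1,\dots,e_n\rangle$ and $J$ the Orlik–Solomon ideal of $\mathsf{M}$. Then $\operatorname{depth}E/J=k$.
   Context: A matroid on $[n]$ is a nonempty family of subsets of $[n]$ (independent sets) containing $\emptyset$, closed under subsets, satisfying the exchange axiom; other subsets are dependent, minimal dependent sets are circuits; a loop is an $i$ with $\{i\}$ dependent. The connected components are the equivalence classes of the relation $x\sim y$ iff $x=y$ or some circuit contains both $x$ and $y$. $E$ is the standard graded exterior algebra; for $S=\{i_0<\dots<i_m\}$, $e_S=e_{i_0}\wedge\dots\wedge e_{i_m}$ and $\partial e_S=\sum_{j=0}^m(-1)^je_{S\setminus\{i_j\}}$; the Orlik–Solomon ideal is $J=(\partial e_S:S\text{ dependent})$. For a graded module $N$, $v\in E_1$ is $N$-regular if $0:_Nv=vN$; a sequence $v_1,\dots,v_s\in E_1$ is $N$-regular if $v_i$ is $N/(v_1,\dots,v_{i-1})N$-regular for each $i$ and $N/(v_1,\dots,v_s)N\neq0$; $\operatorname{depth}N$ is the common length of maximal $N$-regular sequences. *)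

(* Defs.v *)
From HB Require Import structures.
From mathcomp Require Import all_boot all_order all_algebra falgebra.
From mathcomp Require Import boolp classical_sets cardinality.
From mathcomp Require Import fintype finset.

Set Implicit Arguments.
Unset Strict Implicit.
Unset Printing Implicit Defensive.

Import GRing.Theory.
Local Open Scope ring_scope.

(* x S is the coordinate of x on e_S, for S a subset of 'I_n = {0,..,n-1}.    *)
Definition exterior (K : fieldType) (n : nat) : Type := {ffun {set 'I_n} -> K}.

(* Parity of the shuffle sorting the concatenation of S and T.                *)
Definition inversions (n : nat) (S T : {set 'I_n}) : nat :=
  (\sum_(i in S) \sum_(j in T) (j < i)%N)%N.

Section Exterior.
Variables (K : fieldType) (n : nat).
Local Notation E := (exterior K n).
Implicit Types (S T U V : {set 'I_n}) (x y z : E).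

HB.instance Definition _ := Vector.copy E {ffun {set 'I_n} -> K^o}.

(* e_S * e_T = (-1)^(inversions S T) e_(S :|: T) when S and T are disjoint,   *)
(* and 0 otherwise.                                                           *)
Definition ext_mul x y : E :=
  [ffun U : {set 'I_n} => \sum_(S : {set 'I_n} | S \subset U)
     (-1) ^+ inversions S (U :\: S) * (x S * y (U :\: S))].

Definition ext_basis S : E := [ffun T => (T == S)%:R].

Lemma inversionsUl S T U :
  [disjoint S & T] -> inversions (S :|: T) U = (inversions S U + inversions T U)%N.
Proof. by move=> dST; rewrite /inversions -bigU //=; apply: eq_bigl => i; rewrite !inE. Qed.

Lemma inversionsUr S T U :
  [disjoint T & U] -> inversions S (T :|: U) = (inversions S T + inversions S U)%N.
Proof.
move=> dTU; rewrite /inversions -big_split; apply: eq_bigr => i _ /=.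
by rewrite -bigU //=; apply: eq_bigl => j; rewrite !inE.
Qed.

Lemma inversions0l T : inversions set0 T = 0%N.
Proof. by rewrite /inversions big_set0. Qed.

Lemma inversions0r S : inversions S set0 = 0%N.
Proof. by rewrite /inversions big1 // => i _; rewrite big_set0. Qed.

Lemma ext_mulA : associative ext_mul.
Proof.
move=> x y z; apply/ffunP => U; rewrite !ffunE.
under eq_bigr do rewrite ffunE !mulr_sumr.
under [RHS]eq_bigr do rewrite ffunE mulr_suml mulr_sumr.
rewrite [RHS](exchange_big_dep (fun S => S \subset U)) /=; last first.
  by move=> V S VU SV; apply: subset_trans VU.
apply: eq_bigr => S SU.
rewrite [RHS](reindex_onto (fun T => S :|: T) (fun V => V :\: S)) /=; last first.
  by move=> V /andP[VU SV]; rewrite setDE setUIr setUCr setIT; apply/setUidPr.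
apply: eq_big => [T|T].
  rewrite subsetD subUset SU subsetUl andbT /=; congr andb.
  rewrite setDUl setDv set0U; apply/idP/eqP => [dTS|<-].
    by apply/setDidPl.
  by rewrite disjoints_subset setDE subsetIr.
rewrite subsetD => /andP[TU dTS].
have -> : (S :|: T) :\: S = T by rewrite setDUl setDv set0U; apply/setDidPl.
rewrite setDDl.
have dS : [disjoint T & U :\: (S :|: T)].
  by rewrite disjoint_sym disjoints_subset setDE setCU setIA subsetIr.
have -> : U :\: S = T :|: (U :\: (S :|: T)).
  apply/setP => i; rewrite !inE.
  case: (boolP (i \in T)) => iT; rewrite ?orbF ?orbT //=.
  by rewrite (subsetP TU) // andbT (disjointFr dTS).
rewrite inversionsUr // inversionsUl 1?disjoint_sym // !exprD.
rewrite !mulrA; congr (_ * _); rewrite -!mulrA (mulrCA (x S)).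
by rewrite [_ ^+ inversions T _ * (_ ^+ inversions S T * _)]mulrCA [RHS]mulrCA.
Qed.

Lemma ext_mul1l : left_id (ext_basis set0) ext_mul.
Proof.
move=> x; apply/ffunP => U; rewrite ffunE (bigD1 set0) ?sub0set //= big1.
  by rewrite ffunE eqxx setD0 inversions0l !mul1r addr0.
by move=> S /andP[_ /negPf S0]; rewrite ffunE S0 mul0r mulr0.
Qed.

Lemma ext_mul1r : right_id (ext_basis set0) ext_mul.
Proof.
move=> x; apply/ffunP => U; rewrite ffunE (bigD1 U) //= big1.
  by rewrite ffunE setDv eqxx inversions0r !mul1r mulr1 addr0.
move=> S /andP[SU SneU]; rewrite ffunE setD_eq0.
rewrite (_ : U \subset S = false) ?mulr0 //.
by apply: contraNF SneU => US; rewrite eqEsubset SU.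
Qed.

Lemma ext_mulDl : left_distributive ext_mul +%R.
Proof.
move=> x y z; apply/ffunP => U; rewrite !ffunE -big_split /=.
by apply: eq_bigr => S _; rewrite !ffunE mulrDl mulrDr.
Qed.

Lemma ext_mulDr : right_distributive ext_mul +%R.
Proof.
move=> x y z; apply/ffunP => U; rewrite !ffunE -big_split /=.
by apply: eq_bigr => S _; rewrite !ffunE !mulrDr.
Qed.

Lemma ext_basis0_neq0 : ext_basis set0 != 0.
Proof. by apply/eqP => /ffunP/(_ set0)/eqP; rewrite !ffunE eqxx oner_eq0. Qed.

HB.instance Definition _ := GRing.Zmodule_isNzRing.Build E
  ext_mulA ext_mul1l ext_mul1r ext_mulDl ext_mulDr ext_basis0_neq0.

Lemma ext_scaleAl (a : K) x y : a *: (x * y) = a *: x * y.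
Proof.
apply/ffunP => U; rewrite !ffunE scaler_sumr.
by apply: eq_bigr => S _; rewrite ffunE -mulrA [RHS]mulrCA.
Qed.

HB.instance Definition _ := GRing.Lmodule_isLalgebra.Build K E ext_scaleAl.

Lemma ext_scaleAr (a : K) x y : a *: (x * y) = x * (a *: y).
Proof.
apply/ffunP => U; rewrite !ffunE scaler_sumr.
apply: eq_bigr => S _; rewrite ffunE -[LHS]/(a * _) mulrCA; congr (_ * _).
exact: mulrCA.
Qed.

HB.instance Definition _ := GRing.Lalgebra_isAlgebra.Build K E ext_scaleAr.
HB.instance Definition _ := Algebra_isFalgebra.Build K E.

Definition ext_gen (i : 'I_n) : E := ext_basis [set i].

Lemma ext_basisM S T : ext_basis S * ext_basis T =
  if [disjoint S & T] then (-1) ^+ inversions S T *: ext_basis (S :|: T) else 0.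
Proof.
apply/ffunP => U; rewrite [LHS]ffunE.
have [->|neq] := eqVneq U (S :|: T); last first.
  rewrite big1 => [|V VU]; last first.
    rewrite !ffunE; case: eqP => [VS|_]; last by rewrite mul0r mulr0.
    case: eqP => [UT|_]; last by rewrite !mulr0.
    case/eqP: neq; rewrite -UT -VS; apply/setP => i; rewrite !inE.
    by case: (boolP (i \in V)) => // /(subsetP VU).
  by case: ifP => _; rewrite !ffunE // (negPf neq) scaler0.
rewrite (bigD1 S) ?subsetUl //= big1 => [|V /andP[_ /negPf VS]]; last first.
  by rewrite !ffunE VS mul0r mulr0.
rewrite addr0 !ffunE eqxx mul1r setDUl setDv set0U.
have -> : (T :\: S == T) = [disjoint S & T].
  rewrite disjoint_sym; apply/eqP/idP => [<-|/setDidPl//].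
  by rewrite disjoints_subset setDE subsetIr.
case: ifP => [dST|_]; rewrite !ffunE ?mulr0 // eqxx.
by congr (_ ^+ inversions _ _ * _); apply/setDidPl; rewrite disjoint_sym.
Qed.

(* e_S is the product of the e_i, i in S, taken in increasing order.          *)
Lemma ext_basisE S : ext_basis S = \prod_(i <- enum S) ext_gen i.
Proof.
have sorted_enum : sorted (fun i j : 'I_n => (i < j)%N) (enum S).
  rewrite /enum_mem; apply: sorted_filter => [a b c|]; first exact: ltn_trans.
  by have := iota_ltn_sorted 0 n; rewrite -val_enum_ord sorted_map enumT.
have {1}-> : S = [set i in enum S] by apply/setP => i; rewrite inE mem_enum.
elim: (enum S) sorted_enum => [|i s IHs] /= => [_|ps].
  by rewrite big_nil; congr ext_basis; apply/setP => i; rewrite !inE.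
have lt_is : all (fun j : 'I_n => (i < j)%N) s.
  by apply: order_path_min ps => a b c; apply: ltn_trans.
rewrite big_cons -IHs ?(path_sorted ps) // ext_basisM.
have -> : [disjoint [set i] & [set j in s]].
  rewrite disjoints1 inE; apply/negP => /(allP lt_is) /=; by rewrite ltnn.
rewrite /inversions big_set1 big1 => [|j]; last first.
  by rewrite inE => /(allP lt_is) /= ij; rewrite ltnNge ltnW.
by rewrite expr0 scale1r set_cons.
Qed.

Definition ext_homog (d : nat) : set E :=
  [set x : E | forall S, x S != 0 -> #|S| = d]%classic.

(* The j of the sign (-1)^j is the rank of i in S.                            *)
Definition boundary S : E :=
  \sum_(i in S) (-1) ^+ #|[set j in S | (j < i)%N]| *: ext_basis (S :\ i).

End Exterior.

Section Modules.
Variable R : nzRingType.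

Record submodule (N : lmodType R) := Submodule {
  submod_pred :> {pred N};
  submod_closedP : submod_closed submod_pred
}.

HB.instance Definition _ (N : lmodType R) (U : submodule N) :=
  GRing.isSubmodClosed.Build R N (submod_pred U) (submod_closedP U).

Definition two_sided_ideal (I : set R) : Prop :=
  [/\ I 0, forall x y, I x -> I y -> I (x + y)
         & forall a x, I x -> I (a * x) /\ I (x * a)].

Definition ideal_gen (A : set R) : set R := smallest two_sided_ideal A.

Fact ideal_gen_closed (A : set R) :
  submod_closed ((fun x => `[< ideal_gen A x >]) : {pred R^o}).
Proof.
split=> [|a x y].
  by apply/asboolP => I [[]].
move=> /asboolP Ax /asboolP Ay; apply/asboolP => I [iI AI].
have [_ addI mulI] := iI; apply: addI; last exact: Ay.
by case: (mulI a x) => //; apply: Ax.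
Qed.

(* R^o is R as a left module over itself.                                     *)
Definition ideal_submod (A : set R) : submodule R^o :=
  Submodule (ideal_gen_closed A).

Variable N : lmodType R.

Definition is_submodule (U : set N) : Prop :=
  [/\ U 0, forall x y, U x -> U y -> U (x + y)
         & forall (a : R) x, U x -> U (a *: x)].

Fact submod_gen_closed (A : set N) :
  submod_closed ((fun x => `[< smallest is_submodule A x >]) : {pred N}).
Proof.
split=> [|a x y].
  by apply/asboolP => U [[]].
move=> /asboolP Ax /asboolP Ay; apply/asboolP => U [sU AU].
have [_ addU scU] := sU; apply: addU; last exact: Ay.
by apply: scU; apply: Ax.
Qed.

Definition submod_gen (A : set N) : submodule N :=
  Submodule (submod_gen_closed A).

Definition ideal_smul (I : set R) : submodule N :=
  submod_gen [set z | exists a x, I a /\ z = a *: x]%classic.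

End Modules.

Section QuotientModule.
Local Open Scope quotient_scope.
Variables (R : nzRingType) (N : lmodType R) (U : submodule N).

Definition quotmod : Type := @Quotient.quot N (submod_pred U).

HB.instance Definition _ := GRing.Zmodule.on quotmod.

Definition quotmod_proj (x : N) : quotmod := \pi_(@Quotient.quot N (submod_pred U)) x.

Lemma quotmod_projE (x y : N) :
  (quotmod_proj x == quotmod_proj y) = (x - y \in U).
Proof. exact: esym (@Quotient.idealrBE N (submod_pred U) x y). Qed.

Lemma quotmod_proj_surj (q : quotmod) : {x | quotmod_proj x = q}.
Proof. by exists (repr q); rewrite /quotmod_proj reprK. Qed.

Lemma quotmod_projD : {morph quotmod_proj : x y / x + y}.
Proof. exact: raddfD. Qed.

Definition quotmod_scale (a : R) (q : quotmod) : quotmod :=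
  quotmod_proj (a *: repr q).

Lemma quotmod_projZ (a : R) (x : N) :
  quotmod_scale a (quotmod_proj x) = quotmod_proj (a *: x).
Proof.
apply/eqP; rewrite quotmod_projE -scalerBr rpredZ //.
by rewrite -quotmod_projE /quotmod_proj reprK.
Qed.

Fact quotmod_scaleA a b q :
  quotmod_scale a (quotmod_scale b q) = quotmod_scale (a * b) q.
Proof.
by have [x <-] := quotmod_proj_surj q; rewrite !quotmod_projZ scalerA.
Qed.

Fact quotmod_scale1 : left_id 1 quotmod_scale.
Proof.
by move=> q; have [x <-] := quotmod_proj_surj q; rewrite quotmod_projZ scale1r.
Qed.

Fact quotmod_scaleDr : right_distributive quotmod_scale +%R.
Proof.
move=> a p q; have [x <-] := quotmod_proj_surj p.
have [y <-] := quotmod_proj_surj q.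
by rewrite -quotmod_projD !quotmod_projZ scalerDr quotmod_projD.
Qed.

Fact quotmod_scaleDl q : {morph quotmod_scale^~ q : a b / a + b}.
Proof.
move=> a b; have [x <-] := quotmod_proj_surj q.
by rewrite !quotmod_projZ scalerDl quotmod_projD.
Qed.

HB.instance Definition _ := GRing.Zmodule_isLmodule.Build R quotmod
  quotmod_scaleA quotmod_scale1 quotmod_scaleDr quotmod_scaleDl.

End QuotientModule.

(* 0 :_N v = v N                                                              *)
Definition regular_elt (R : nzRingType) (N : lmodType R) (v : R) : Prop :=
  [set x : N | v *: x = 0]%classic = range (fun y : N => v *: y).

Section Depth.
Variables (K : fieldType) (n : nat).
Local Notation E := (exterior K n).
Variable N : lmodType E.

(* N / (v_1, ..., v_s) N, where vs = [:: v_1; ...; v_s]                       *)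
Definition quot_seq (vs : seq E) : lmodType E :=
  quotmod (ideal_smul N (ideal_gen [set v | v \in vs]%classic)).

Definition regular_seq (vs : seq E) : Prop :=
  [/\ forall v, v \in vs -> ext_homog 1 v,
      forall i, (i < size vs)%N -> regular_elt (quot_seq (take i vs)) vs`_i
    & exists x : quot_seq vs, x != 0].

Definition maximal_regular_seq (vs : seq E) : Prop :=
  regular_seq vs /\ forall v, ~ regular_seq (rcons vs v).

(* Depth as a relation: the common length of the maximal N-regular sequences, *)
(* so that the well-definedness of depth N is part of has_depth N d.          *)
Definition has_depth (d : nat) : Prop :=
  (exists vs, maximal_regular_seq vs) /\
  (forall vs, maximal_regular_seq vs -> size vs = d).

End Depth.

Record matroid (n : nat) := Matroid {
  indep : {set {set 'I_n}};
  indep0 : set0 \in indep;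
  indep_sub : forall A B : {set 'I_n}, A \subset B -> B \in indep -> A \in indep;
  indep_exchange : forall A B : {set 'I_n}, A \in indep -> B \in indep ->
    (#|A| < #|B|)%N -> exists2 x, x \in B :\: A & x |: A \in indep
}.

Section Matroid.
Variables (n : nat) (M : matroid n).

Definition dependent (S : {set 'I_n}) : bool := S \notin indep M.

Definition circuit (C : {set 'I_n}) : bool := minset dependent C.

Definition loop (i : 'I_n) : bool := dependent [set i].

Definition loopless : Prop := forall i, ~~ loop i.

Definition connected_elts (x y : 'I_n) : bool :=
  (x == y) || [exists C, [&& circuit C, x \in C & y \in C]].

Definition connected_components : {set {set 'I_n}} :=
  equivalence_partition connected_elts [set: 'I_n].

Variable K : fieldType.

Definition OS_ideal : submodule (exterior K n)^o :=
  ideal_submod [set boundary K S | S in [set S | dependent S]]%classic.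

Definition OS_algebra : lmodType (exterior K n) := quotmod OS_ideal.

End Matroid.

(* Main.v *)
Require Import Defs.
From mathcomp Require Import all_boot all_algebra.
From mathcomp Require Import classical_sets cardinality.
From HB Require Import structures.
From mathcomp Require Import order boolp zify ring.
From mathcomp Require Import fintype finset.

(* Summing the coordinates of v in E_1 over each connected component defines a
   surjection phi : E_1 -> K^k, and a sequence in E_1 is E/J-regular if and only
   if its image under phi is linearly independent.
   If it is independent, a linear form on K^k separating v from its predecessors
   yields a contraction D of E that preserves J and kills these predecessors,
   and D (v x) = x - v (D x) shows that v is regular.
   Conversely, it is enough that no w with phi w = 0 is E/J-regular.  If w were,
   it would also be regular on B = E/(J + (e_m)_m), where m runs over the minima
   of the components.  The monomials on the sets that contain no broken circuit
   and none of the m form a basis of B, and exactness of the multiplication by w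
   forces as many of them to be even as odd.  Their signed number, however, is up
   to sign the product of the beta invariants of the components.  It is nonzero by
   deletion and contraction of the largest element, because one of the two
   preserves connectedness. *)

Set Implicit Arguments.
Unset Strict Implicit.
Unset Printing Implicit Defensive.

Import GRing.Theory Num.Theory.

(** * Rank functions and separators *)

(** Counting on E/J itself would give no contradiction. No broken circuit contains the least element
    of the ground set, so adding or removing that element preserves the absence of broken circuits,
    and the even and odd basis sets always cancel. This is why one generator per component is killed
    first. Killing e_m keeps w regular because the contraction with the indicator of the component
    of m preserves J, sends e_m to 1 and sends w to 0. The minima are the right generators to kill.
    A minimum m lies outside the closure of every set that avoids the minima and contains no broken
    circuit, so the functionals that prove the independence of the monomials modulo J also vanish on
    the multiples of e_m. Each such functional comes from the flag of flats spanned by the upper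
    segments of a set, and its pairing with the monomials is triangular for the sum of the
    elements. *)

Section Rank.
Variable T : finType.
Implicit Types (r : {set T} -> nat) (A B C G P Q R X Y : {set T}) (e g x y : T).

(** With rank functions, deletion only shrinks the ground set [G] and contraction only changes [r],
    so inductions over minors stay on one type. *)
Definition rank_function r : Prop :=
  [/\ forall A, r A <= #|A|,
      forall A B, A \subset B -> r A <= r B
    & forall A B, r (A :|: B) + r (A :&: B) <= r A + r B].

Definition contract r e A : nat := r (e |: A) - r [set e].

Definition separator r G X : bool := (X \subset G) && (r X + r (G :\: X) == r G).

(** For [R = [set x]] with [x] in [G] this is connectedness, since the complement of a separator
    containing [x] avoids [x] and must be empty. A larger [R] treats all components in one
    induction. *)
Definition meets_separators r G R : Prop :=
  forall X, separator r G X -> X != set0 -> X :&: R != set0.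

Definition rank_circuit r C : bool :=
  [&& C != set0, (r C).+1 == #|C| & [forall x in C, r (C :\ x) == r C]].

Lemma separatorP r G X :
  reflect (X \subset G /\ r X + r (G :\: X) = r G) (separator r G X).
Proof. by apply: (iffP andP) => -[XG /eqP]. Qed.

Lemma separatorC r G X : separator r G X -> separator r G (G :\: X).
Proof.
by case/separatorP=> XG /eqP rX; rewrite /separator subsetDl setDDr setDv set0U (setIidPr XG) addnC.
Qed.

Section RankFunction.
Variable r : {set T} -> nat.
Hypothesis rk : rank_function r.

Lemma rank_le_card A : r A <= #|A|. Proof. by case: rk. Qed.
Lemma rank_mono A B : A \subset B -> r A <= r B. Proof. by case: rk => _ + _; apply. Qed.
Lemma rank_submod A B : r (A :|: B) + r (A :&: B) <= r A + r B.
Proof. by case: rk. Qed.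

Lemma rank_set0 : r set0 = 0.
Proof. by have := rank_le_card set0; rewrite cards0; lia. Qed.

Lemma rank_setU A B : r (A :|: B) <= r A + r B.
Proof. by have := rank_submod A B; lia. Qed.

Lemma rank_setU1 x A : r (x |: A) <= (r A).+1.
Proof.
have := rank_setU [set x] A; have := rank_le_card [set x]; rewrite cards1; lia.
Qed.

(** Here and below, [r (x |: A) = r A] encodes that [x] lies in the closure of [A]. *)
Lemma closure_mono x A B :
  A \subset B -> r (x |: A) = r A -> r (x |: B) = r B.
Proof.
move=> AB xA; have := rank_submod (x |: A) B; rewrite -setUA (setUidPr AB).
have : r A <= r ((x |: A) :&: B) by apply: rank_mono; rewrite subsetI subsetUr.
by have := rank_mono (subsetUr [set x] B); lia.
Qed.

Lemma closure_trans x A B :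
  (forall b, b \in B -> r (b |: A) = r A) -> r (x |: B) = r B -> r (x |: A) = r A.
Proof.
move=> BA xB; have rAB : r (A :|: B) = r A.
  have -> : A :|: B = A :|: [set b in enum B] by apply/setP => b; rewrite !inE mem_enum.
  have : {subset enum B <= B} by move=> b; rewrite mem_enum.
  elim: (enum B) => [|b s IHs] sB; first by rewrite set_nil setU0.
  rewrite set_cons setUCA (closure_mono (subsetUl _ _)).
    by apply: IHs => c cs; apply: sB; rewrite inE cs orbT.
  by apply/BA/sB; rewrite mem_head.
have := closure_mono (subsetUr A B) xB; rewrite setUCA rAB.
have := rank_mono (setUS [set x] (subsetUl A B)); rewrite setUCA.
by have := rank_mono (subsetUr [set x] A); lia.
Qed.

Lemma contract_rank e : rank_function (contract r e).
Proof.
split=> [A|A B AB|A B]; rewrite /contract.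
- by have := rank_setU [set e] A; have := rank_le_card A; lia.
- by have := rank_mono (setUS [set e] AB); lia.
have := rank_submod (e |: A) (e |: B); rewrite -setUUr -setUIr.
have := rank_mono (subsetUl [set e] (A :&: B)).
have := rank_mono (subsetUl [set e] (A :|: B)).
by have := rank_mono (subsetUl [set e] A); have := rank_mono (subsetUl [set e] B); lia.
Qed.

(** Submodularity for the pair [A], [X] and for the pair [A :|: X], [G :\: X] adds up to the
    nontrivial inequality. *)
Lemma separator_split G X A :
  separator r G X -> A \subset G -> r A = r (A :&: X) + r (A :\: X).
Proof.
case/separatorP=> XG rX AG.
have := rank_setU (A :&: X) (A :\: X); rewrite setID.
have := rank_submod A X; have := rank_submod (A :|: X) (G :\: X).
have -> : (A :|: X) :|: (G :\: X) = G.
  apply/setP => i; rewrite !inE; have /implyP := subsetP XG i; have /implyP := subsetP AG i.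
  by case: (i \in A); case: (i \in X); case: (i \in G) => //=.
have -> : (A :|: X) :&: (G :\: X) = A :\: X.
  apply/setP => i; rewrite !inE; have /implyP := subsetP AG i.
  by case: (i \in A); case: (i \in X); case: (i \in G) => //=.
lia.
Qed.

Lemma separatorI G X Y : separator r G X -> separator r G Y -> separator r G (X :&: Y).
Proof.
move=> sX sY; have /separatorP[XG rX] := sX; have /separatorP[YG rY] := sY.
apply/separatorP; split; first by rewrite subIset ?XG.
have := separator_split sY XG; have := separator_split sX (subsetDl G (X :&: Y)).
have -> : (G :\: (X :&: Y)) :&: X = X :\: Y.
  apply/setP => i; rewrite !inE; have /implyP := subsetP XG i.
  by case: (i \in X); case: (i \in Y); case: (i \in G) => //=.
have -> : (G :\: (X :&: Y)) :\: X = G :\: X.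
  by apply/setP => i; rewrite !inE; case: (i \in X); case: (i \in Y); case: (i \in G).
lia.
Qed.

Lemma separator_delete G X e : separator r G X -> separator r (G :\ e) (X :\ e).
Proof.
move=> sX; have /separatorP[XG rX] := sX; apply/separatorP; split; first exact: setSD.
have := separator_split sX (subsetDl G [set e]).
rewrite setIDAC (setIidPr XG) => ->; congr (_ + r _); apply/setP => i; rewrite !inE.
by case: (i == e); case: (i \in X); case: (i \in G).
Qed.

Lemma separator_contract G X e : e \in G -> separator r G X ->
  separator (contract r e) (G :\ e) (X :\ e).
Proof.
move=> eG; wlog eX : X / e \in X => [hw|] sX.
  have [/hw/(_ sX)//|eX] := boolP (e \in X).
  have /separatorP[XG _] := sX.
  have := separatorC (hw (G :\: X) _ (separatorC sX)); rewrite inE eG eX => /(_ isT).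
  congr (separator _ _ _); apply/setP => i; rewrite !inE.
  have /implyP := subsetP XG i; have : (i == e) ==> (i \notin X) by apply/implyP => /eqP ->.
  by case: (i == e); case: (i \in X); case: (i \in G).
have /separatorP[XG rX] := sX; apply/separatorP; split; first exact: setSD.
rewrite /contract !setD1K //.
have -> : e |: (G :\ e :\: (X :\ e)) = e |: (G :\: X).
  by apply/setP => i; rewrite !inE; case: eqP => [->|] //=; rewrite eX.
have eGX : e |: (G :\: X) \subset G by rewrite subUset sub1set eG subsetDl.
rewrite (separator_split sX eGX).
have -> : (e |: (G :\: X)) :&: X = [set e].
  apply/setP => i; rewrite !inE; case: eqP => [->|_] /=; first by rewrite eX.
  by case: (i \in X); case: (i \in G).
have -> : (e |: (G :\: X)) :\: X = G :\: X.
  apply/setP => i; rewrite !inE; case: eqP => [->|_] /=; first by rewrite eX.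
  by case: (i \in X); case: (i \in G).
have : r [set e] <= r X by apply: rank_mono; rewrite sub1set.
have : r [set e] <= r G by apply: rank_mono; rewrite sub1set.
lia.
Qed.

(** A coloop [e] would make [[set e]] a separator that avoids [R]. *)
Lemma not_coloop G R e : meets_separators r G R -> e \in G -> e \notin R ->
  r (G :\ e) = r G.
Proof.
move=> GR eG eR; apply/eqP; apply: contraTT isT => neq.
have : separator r G [set e].
  rewrite /separator sub1set eG /=; have := rank_setU [set e] (G :\ e).
  have := rank_mono (subsetDl G [set e]); have := rank_le_card [set e].
  rewrite setD1K // cards1; lia.
move/GR => /(_ _)/set0Pn; case=> [|i].
  by apply/set0Pn; exists e; rewrite set11.
by rewrite !inE => /andP[/eqP-> eR1]; rewrite eR1 in eR.
Qed.

(* Tutte: the deletion or the contraction of an element of a connected matroid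
   is connected.  If X separates the deletion and P the contraction,
   submodularity applied to X, e |: P and to their complements produces a
   separator of the matroid itself among X :&: P and its analogues. *)
Lemma delete_or_contract G R e :
  meets_separators r G R -> e \in G -> e \notin R ->
  meets_separators r (G :\ e) R \/ meets_separators (contract r e) (G :\ e) R.
Proof.
move=> GR eG eR; have Ge := not_coloop GR eG eR.
apply/or_asboolP; apply/negPn/negP; rewrite negb_or => /andP[/asboolPn nX /asboolPn nP].
have [X [sX X0 XR]] : exists X, [/\ separator r (G :\ e) X, X != set0 & X :&: R = set0].
  apply: contrapT => h; apply: nX => X sX X0; apply/eqP => XR; apply: h.
  by exists X.
have [P [sP P0 PR]] :
    exists P, [/\ separator (contract r e) (G :\ e) P, P != set0 & P :&: R = set0].
  apply: contrapT => h; apply: nP => P sP P0; apply/eqP => PR; apply: h.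
  by exists P.
have /separatorP[XG rX] := sX; have /separatorP[PG rP] := sP.
set Y := G :\ e :\: X in rX; set Q := G :\ e :\: P in rP.
have avoid (Z : {set T}) : Z \subset G -> Z :&: R = set0 -> r Z + r (G :\: Z) <= r G -> Z = set0.
  move=> ZG ZR rZ; apply/eqP/negPn/negP => Z0; move: ZR; apply/eqP/GR => //.
  apply/separatorP; split=> //; have := rank_setU Z (G :\: Z).
  have -> : Z :|: (G :\: Z) = G.
    by apply/setP => i; rewrite !inE; have /implyP := subsetP ZG i; case: (i \in Z); case: (i \in G).
  lia.
have subX (Z : {set T}) : Z \subset X -> Z :&: R = set0.
  by move=> ZX; apply/eqP; rewrite -subset0 -XR setSI.
have subP (Z : {set T}) : Z \subset P -> Z :&: R = set0.
  by move=> ZX; apply/eqP; rewrite -subset0 -PR setSI.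
(* The two submodular inequalities bound the sum of these four ranks by [2 * r G + 1], so one of the
   two pairs is at most [r G]. The statement is used for both orders of [P] and [Q]. *)
have key (P' Q' : {set T}) : P' :|: Q' = G :\ e -> P' :&: Q' = set0 ->
  r (e |: P') + r (e |: Q') <= (r G).+1 ->
  r (X :&: P') + r (G :\: (X :&: P')) <= r G \/ r (Y :&: Q') + r (G :\: (Y :&: Q')) <= r G.
  move=> PQU PQI rPQ.
  have := rank_submod X (e |: P'); have := rank_submod Y (e |: Q').
  have inG i : [/\ (i \in X) ==> (i \in G) && (i != e), (i == e) ==> (i \in G) & 
    (i \in G) && (i != e) = (i \in P') || (i \in Q')] /\ ~~ ((i \in P') && (i \in Q')).
    split; last by rewrite -in_setI PQI inE.
    split; first by apply/implyP => /(subsetP XG); rewrite !inE andbC.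
      by apply/implyP => /eqP ->.
    by rewrite -in_setU PQU !inE andbC.
  have -> : X :|: (e |: P') = G :\: (Y :&: Q').
    apply/setP => i; rewrite !inE; have [[]] := inG i.
    by case: (i \in X); case: (i == e); case: (i \in G); case: (i \in P'); case: (i \in Q').
  have -> : X :&: (e |: P') = X :&: P'.
    apply/setP => i; rewrite !inE; have [[]] := inG i.
    by case: (i \in X); case: (i == e); case: (i \in G); case: (i \in P'); case: (i \in Q').
  have -> : Y :|: (e |: Q') = G :\: (X :&: P').
    apply/setP => i; rewrite !inE; have [[]] := inG i.
    by case: (i \in X); case: (i == e); case: (i \in G); case: (i \in P'); case: (i \in Q').
  have -> : Y :&: (e |: Q') = Y :&: Q'.
    apply/setP => i; rewrite !inE; have [[]] := inG i.
    by case: (i \in X); case: (i == e); case: (i \in G); case: (i \in P'); case: (i \in Q').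
  lia.
have PQU : P :|: Q = G :\ e.
  apply/setP => i; rewrite !inE; have /implyP := subsetP PG i; rewrite !inE.
  by case: (i \in P); case: (i == e); case: (i \in G).
have PQI : P :&: Q = set0 by apply/setP => i; rewrite !inE; case: (i \in P).
have rPQ : r (e |: P) + r (e |: Q) <= (r G).+1.
  move: rP; rewrite /contract setD1K //; have := rank_mono (subsetUl [set e] P).
  have := rank_mono (subsetUl [set e] Q); have := rank_le_card [set e]; rewrite cards1.
  have : r [set e] <= r G by apply: rank_mono; rewrite sub1set.
  lia.
have rQP : r (e |: Q) + r (e |: P) <= (r G).+1 by rewrite addnC.
have subG (Z W : {set T}) : (Z \subset X) || (Z \subset Y) -> Z :&: W \subset G.
  move=> h; apply: (subset_trans (subsetIl _ _)); apply: subset_trans (subsetDl G [set e]).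
  by case/orP: h => /subset_trans; apply => //; apply: subsetDl.
(* In the other alternative [Y :&: Q] is a separator of [G]; its complement contains [e] but avoids
   [R], which is impossible. *)
have case1 : X :&: P = set0.
  have [h|h] := key P Q PQU PQI rPQ.
    by apply: avoid h; [apply: subG; rewrite subxx | apply: subX; rewrite subsetIl].
  have : G :\: (Y :&: Q) = set0.
    apply: avoid; rewrite ?subsetDl //.
      apply/setP => i; rewrite !inE.
      have /setP/(_ i) := PR; have /setP/(_ i) := XR; rewrite !inE.
      have : (i == e) ==> (i \notin R) by apply/implyP => /eqP ->.
      by case: (i \in X); case: (i == e); case: (i \in G); case: (i \in P); case: (i \in R).
    have YQG : Y :&: Q \subset G by apply: subG; rewrite subxx orbT.
    by rewrite [G :\: (G :\: _)]setDDr setDv set0U (setIidPr YQG) addnC.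
  by move/setP/(_ e); rewrite !inE eqxx eG /= andbF.
have [h|h] := key Q P (etrans (setUC _ _) PQU) (etrans (setIC _ _) PQI) rQP.
  case/set0Pn: X0 => i iX; have /setP/(_ i) := case1.
  have : X :&: Q = set0.
    by apply: avoid h; [apply: subG; rewrite subxx | apply: subX; rewrite subsetIl].
  move/setP/(_ i); have := subsetP XG i iX; rewrite !inE iX.
  by case: (i == e); case: (i \in G); case: (i \in P).
case/set0Pn: P0 => i iP; have /setP/(_ i) := case1.
have : Y :&: P = set0.
  by apply: avoid h; [apply: subG; rewrite subxx orbT | apply: subP; rewrite subsetIr].
move/setP/(_ i); have := subsetP PG i iP; rewrite !inE iP.
by case: (i == e); case: (i \in G); case: (i \in X).
Qed.

End RankFunction.
End Rank.

(** * Circuits through two elements of a connected matroid *)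

Section CommonCircuit.
Variable T : finType.
Implicit Types (r : {set T} -> nat) (C G R X : {set T}) (e x y : T).

Lemma nonloop r G R e : rank_function r -> meets_separators r G R ->
  e \in G -> e \notin R -> r [set e] = 1.
Proof.
move=> rk GR eG eR; apply/eqP; apply: contraTT isT => re.
have : separator r G [set e].
  rewrite /separator sub1set eG /=; have := rank_setU rk [set e] (G :\ e).
  have := rank_mono rk (subsetDl G [set e]); have := rank_le_card rk [set e].
  rewrite setD1K // cards1; lia.
move/GR => /(_ _)/set0Pn; case=> [|i]; first by apply/set0Pn; exists e; rewrite set11.
by rewrite !inE => /andP[/eqP-> eR1]; rewrite eR1 in eR.
Qed.

(** If [C] has full rank before the contraction, then [e |: C] is the circuit; otherwise [C] itself
    already is one. *)
Lemma rank_circuit_lift r e C : rank_function r -> r [set e] = 1 -> e \notin C ->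
  rank_circuit (contract r e) C ->
  exists D : {set T}, [/\ C \subset D, D \subset e |: C & rank_circuit r D].
Proof.
move=> rk re eC /and3P[C0 /eqP rC /forall_inP rCx]; move: rC rCx.
rewrite /contract re => rC rCx.
have rCx' x : x \in C -> r (e |: C :\ x) = #|C|.
  move=> xC; have /eqP := rCx _ xC; have := rank_mono rk (subsetUl [set e] (C :\ x)).
  have := rank_mono rk (subsetUl [set e] C); rewrite re; lia.
have rCe : r (e |: C) = #|C|.
  by have := rank_mono rk (subsetUl [set e] C); rewrite re; lia.
have [rC1|rC1] := eqVneq (r C) #|C|.
  exists (e |: C); rewrite subsetUr subxx; split=> //; apply/and3P; split.
  - by apply/set0Pn; exists e; rewrite setU11.
  - by rewrite cardsU1 eC rCe.
  apply/forall_inP => x; rewrite !inE => /orP[/eqP->|xC].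
    by rewrite setU1K // rCe rC1.
  rewrite rCe -(rCx' x xC); apply/eqP; congr r.
  by apply/setP => i; rewrite !inE; case: eqP => [->|] //=; case: eqP xC eC => // -> ->.
exists C; rewrite subsetUr subxx; split=> //; apply/and3P; split=> //.
  have := rank_setU1 rk e C; have := rank_le_card rk C; rewrite rCe; lia.
apply/forall_inP => x xC.
have := rank_setU1 rk e C; have := rank_le_card rk C; have := rank_setU1 rk e (C :\ x).
have := rank_le_card rk (C :\ x); have := cardsD1 x C; rewrite xC rCe rCx' //; lia.
Qed.

(** Elements other than [x] and [y] are removed one at a time by a deletion or contraction that
    keeps the matroid connected, and circuits lift back through both operations. *)
Lemma common_circuit r G x y : rank_function r -> meets_separators r G [set x] ->
  x \in G -> y \in G -> x != y ->
  exists C : {set T}, [/\ C \subset G, rank_circuit r C, x \in C & y \in C].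
Proof.
move: {2}#|G| (leqnn #|G|) => m; elim: m r G => [|m IHm] r G.
  by rewrite leqn0 cards_eq0 => /eqP-> _ _; rewrite inE.
move=> Gm rk Gx xG yG xy.
have [/existsP[e /and3P[eG ex ey]]|none] :=
  boolP [exists e, [&& e \in G, e != x & e != y]].
  have Gem : #|G :\ e| <= m by have := cardsD1 e G; rewrite eG; lia.
  have eX : e \notin [set x] by rewrite inE.
  have xGe : x \in G :\ e by rewrite !inE eq_sym ex.
  have yGe : y \in G :\ e by rewrite !inE eq_sym ey.
  have [del|con] := delete_or_contract rk Gx eG eX.
    have [C [CG Cc xC yC]] := IHm _ _ Gem rk del xGe yGe xy.
    by exists C; split=> //; apply: subset_trans CG (subsetDl _ _).
  have [C [CG Cc xC yC]] := IHm _ _ Gem (contract_rank rk e) con xGe yGe xy.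
  have eC : e \notin C by apply: contraTN isT => /(subsetP CG); rewrite !inE eqxx.
  have [D [CD DC Dc]] := rank_circuit_lift rk (nonloop rk Gx eG eX) eC Cc.
  exists D; split=> //; [|exact: (subsetP CD)|exact: (subsetP CD)].
  apply: subset_trans DC _; rewrite subUset sub1set eG.
  exact: subset_trans CG (subsetDl _ _).
(* Only [x] and [y] remain. Connectedness makes them parallel, so [G] itself is the circuit. *)
have GE : G = [set x; y].
  apply/setP => i; rewrite !inE; apply/idP/orP => [iG|[/eqP->|/eqP->]] //.
  have /existsPn/(_ i) := none; rewrite iG /=; case: eqP; case: eqP; auto.
have ry : r [set y] = 1 by apply: nonloop Gx yG _ => //; rewrite inE eq_sym.
have nsep X : X \subset G -> X != set0 -> x \notin X -> r X + r (G :\: X) != r G.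
  move=> XG X0 xX; apply/negP => rX; have := Gx X; rewrite /separator XG rX => /(_ isT X0)/set0Pn.
  by case=> i; rewrite !inE => /andP[iX /eqP ix]; rewrite -ix iX in xX.
have := nsep [set y]; rewrite inE (negPf xy) sub1set yG => /(_ isT _ isT).
have -> : G :\: [set y] = [set x].
  by rewrite GE; apply/setP => i; rewrite !inE; case: eqP => [->|_]; rewrite ?orbF // eq_sym (negPf xy).
rewrite ry => /(_ _)/eqP h.
have {}h : 1 + r [set x] <> r G by apply: h; apply/set0Pn; exists y; rewrite set11.
have := rank_setU rk [set x] [set y]; rewrite -GE ry.
have := rank_le_card rk [set x]; rewrite cards1.
have : r [set y] <= r G by apply: rank_mono; rewrite // sub1set.
rewrite ry => h1 h2 h3; have rx : r [set x] = 1 by lia.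
have rG : r G = 1 by lia.
exists G; split=> //; apply/and3P; split.
- by apply/set0Pn; exists x.
- by rewrite rG GE cards2 xy.
have Gx' : G :\ x = [set y].
  by rewrite GE; apply/setP => i; rewrite !inE; case: eqP => [->|_] /=; rewrite ?(negPf xy).
have Gy' : G :\ y = [set x].
  by rewrite GE; apply/setP => i; rewrite !inE; case: eqP => [->|_]; rewrite ?orbF // eq_sym (negPf xy).
by apply/forall_inP => i; rewrite {1}GE !inE => /orP[]/eqP->; rewrite ?Gx' ?Gy' rG ?ry ?rx.
Qed.
End CommonCircuit.

(** * Signed number of sets without broken circuit *)

Section NBC.
Variable n : nat.
Implicit Types (r : {set 'I_n} -> nat) (S G R X : {set 'I_n}) (g i j m : 'I_n).
Local Open Scope ring_scope.

Definition above j S : {set 'I_n} := [set i in S | (j < i)%N].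

(* S contains no broken circuit [C :\ min C] of the matroid r on G: if it did,
   then min C would lie in the closure of the elements of S above it. *)
Definition nbc r G S : bool :=
  (S \subset G) && [forall j in G, (r (above j S) < r (j |: above j S))%N].

Definition nbc_sum r G R : int :=
  \sum_(S | nbc r G S && [disjoint S & R]) (-1) ^+ #|S|.

(** The separator need not be a component: minors can break components up, and this weaker condition
    is inherited by deletion and contraction. *)
Definition separator_minima r G R : Prop :=
  forall m, m \in R -> exists X,
    [/\ separator r G X, m \in X & forall i, i \in X -> (m <= i)%N].

(** No element of [S] lies above the largest element [g], so the condition at [g] only says that [g]
    is not a loop. *)
Lemma nbc_delete r G g S : rank_function r -> g \in G -> (forall j, j \in G -> (j <= g)%N) ->
  (0 < r [set g])%N -> g \notin S -> nbc r G S = nbc r (G :\ g) S.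
Proof.
move=> rk gG gmax rg gS; rewrite /nbc subsetD1 gS andbT; apply: andb_id2l => SG.
apply/forall_inP/forall_inP => h j; first by rewrite inE => /andP[_]; apply: h.
have [-> _|jg jG] := eqVneq j g; last by apply: h; rewrite !inE jg.
have -> : above g S = set0.
  by apply/setP => i; rewrite !inE; apply/negP => /andP[/(subsetP SG)/gmax]; lia.
by rewrite setU0 (rank_set0 rk).
Qed.

(** The largest element [g] lies above every other [j], so each of the sets whose ranks are compared
    at [j] contains [g], and the comparison is one of ranks in the contraction. This is why the
    recursion removes the largest element. *)
Lemma nbc_contract r G g S : rank_function r -> g \in G -> (forall j, j \in G -> (j <= g)%N) ->
  (0 < r [set g])%N -> S \subset G :\ g -> nbc r G (g |: S) = nbc (contract r g) (G :\ g) S.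
Proof.
move=> rk gG gmax rg SG; rewrite /nbc SG subUset sub1set gG.
rewrite (subset_trans SG (subsetDl _ _)) /=.
have jE j : j \in G :\ g ->
  (r (above j (g |: S)) < r (j |: above j (g |: S)))%N =
  (contract r g (above j S) < contract r g (j |: above j S))%N.
  rewrite !inE => /andP[jg jG]; have lt_jg : (j < g)%N.
    by rewrite ltn_neqAle gmax // andbT.
  have -> : above j (g |: S) = g |: above j S.
    by apply/setP => i; rewrite !inE; case: eqP => [->|] //=.
  rewrite /contract (setUCA [set j]); have := rank_mono rk (subsetUl [set g] (above j S)).
  have := rank_mono rk (subsetUl [set g] (j |: above j S)) => le1 le2.
  move: (r [set g]) (r (g |: above j S)) (r (g |: (j |: above j S))) le1 le2.
  by move=> a b c le1 le2; lia.
apply/forall_inP/forall_inP => h j.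
  by move=> jG; rewrite -jE //; apply: h; move: jG; rewrite inE => /andP[].
have [-> _|jg jG] := eqVneq j g; last by rewrite jE ?h // !inE jg.
have -> : above g (g |: S) = set0.
  apply/setP => i; rewrite !inE; apply/negP => /andP[/orP[/eqP->|/(subsetP SG)]].
    by rewrite ltnn.
  by rewrite !inE => /andP[_ /gmax]; lia.
by rewrite setU0 (rank_set0 rk).
Qed.

Lemma nbc_sum_rec r G R g : rank_function r -> g \in G -> (forall j, j \in G -> (j <= g)%N) ->
  (0 < r [set g])%N ->
  nbc_sum r G R = nbc_sum r (G :\ g) R -
    (if g \in R then 0 else nbc_sum (contract r g) (G :\ g) R).
Proof.
move=> rk gG gmax rg; rewrite /nbc_sum (bigID (fun S => g \in S)) /= addrC; congr (_ + _).
  apply: eq_bigl => S; have [gS|gS] := boolP (g \in S); last by rewrite andbT (@nbc_delete r G g).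
  by rewrite andbF /nbc subsetD1 gS andbF.
case: ifP => gR.
  rewrite oppr0 big1 // => S /andP[/andP[_ dSR] gS].
  by rewrite (disjointFr dSR gS) in gR.
rewrite (reindex_onto (fun S => g |: S) (fun S => S :\ g)) /=; last first.
  by move=> S /andP[_ gS]; rewrite setD1K.
rewrite -sumrN; apply: eq_big => [S|S].
  rewrite setU11 andbT; have [gS|gS] := boolP (g \in S).
    rewrite [nbc _ _ S]/nbc subsetD1 gS andbF /=; apply/negbTE; apply/negP => /andP[_ /eqP E].
    by move: gS; rewrite -E !inE eqxx.
  rewrite setU1K // eqxx andbT; have [SG|SG] := boolP (S \subset G :\ g).
    rewrite nbc_contract // disjoints_subset subUset sub1set inE gR /=.
    by rewrite -disjoints_subset.
  rewrite /nbc (negPf SG) subUset sub1set gG /=; move: SG; rewrite subsetD1 gS andbT => /negPf->.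
  by [].
move=> /andP[/andP[_ _] /eqP E]; rewrite cardsU1.
have -> : g \notin S by rewrite -E !inE eqxx.
by rewrite exprS mulN1r.
Qed.

End NBC.

(** * Sign and positivity of the signed number *)

Section NBCSign.
Variable n : nat.
Implicit Types (r : {set 'I_n} -> nat) (A S G R X : {set 'I_n}) (g i j m : 'I_n).
Local Open Scope ring_scope.

Lemma separator_minima_delete r G R g : rank_function r ->
  separator_minima r G R -> separator_minima r (G :\ g) (R :\ g).
Proof.
move=> rk RG m; rewrite !inE => /andP[mg /RG[X [sX mX minX]]].
exists (X :\ g); rewrite !inE mg mX; split=> //; first exact: separator_delete.
by move=> i; rewrite !inE => /andP[_ /minX].
Qed.

Lemma separator_minima_contract r G R g : rank_function r -> g \in G ->
  separator_minima r G R -> separator_minima (contract r g) (G :\ g) (R :\ g).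
Proof.
move=> rk gG RG m; rewrite !inE => /andP[mg /RG[X [sX mX minX]]].
exists (X :\ g); rewrite !inE mg mX; split=> //; first exact: separator_contract.
by move=> i; rewrite !inE => /andP[_ /minX].
Qed.

Lemma nbc_sumD1 r G R g : nbc_sum r (G :\ g) R = nbc_sum r (G :\ g) (R :\ g).
Proof.
apply: eq_bigl => S; rewrite /nbc subsetD1; case: (boolP (g \in S)) => gS.
  by rewrite andbF.
congr (_ && _); rewrite -!setI_eq0; congr (_ == _); apply/setP => i; rewrite !inE.
by case: eqP => [->|] //; rewrite (negPf gS).
Qed.

Lemma nbc_sum_loop r G R g : g \in G -> rank_function r -> r [set g] = 0%N -> nbc_sum r G R = 0.
Proof.
move=> gG rk rg; apply: big1 => S /andP[/andP[_ /forall_inP/(_ g gG)]].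
by rewrite (closure_mono rk (sub0set _)) ?ltnn // setU0 rg (rank_set0 rk).
Qed.

Lemma rank_coloop r G g A : rank_function r -> g \in G -> (r (G :\ g) < r G)%N ->
  A \subset G :\ g -> r (g |: A) = (r A).+1.
Proof.
move=> rk gG rG; rewrite subsetD1 => /andP[AG gA].
have := rank_setU rk [set g] (G :\ g); have := rank_le_card rk [set g].
rewrite setD1K // cards1 => h1 h2; have rg : r [set g] = 1%N by lia.
have sg : separator r G [set g] by apply/separatorP; rewrite sub1set; split=> //; lia.
rewrite (separator_split rk sg) ?subUset ?sub1set ?gG // setUK setU1K // rg; lia.
Qed.

(** Together with [nbc_sum_rec] this makes the sum vanish when the largest element is a coloop
    outside [R]. *)
Lemma nbc_sum_coloop r G R g : rank_function r -> g \in G -> (r (G :\ g) < r G)%N ->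
  nbc_sum (contract r g) (G :\ g) R = nbc_sum r (G :\ g) R.
Proof.
move=> rk gG rG; have rg : r [set g] = 1%N.
  by rewrite -[[set g]]setU0 (rank_coloop rk gG rG) ?sub0set // (rank_set0 rk).
have cE (A : {set 'I_n}) : A \subset G :\ g -> contract r g A = r A.
  by move=> AG; rewrite /contract (rank_coloop rk gG rG) // rg subn1.
apply: eq_bigl => S; congr (_ && _); rewrite /nbc; apply: andb_id2l => SG.
have aG j : above j S \subset G :\ g.
  by apply: subset_trans SG; apply/subsetP => i; rewrite inE => /andP[].
apply/forall_inP/forall_inP => h j jG; have := h j jG;
  by rewrite !cE // subUset sub1set jG aG.
Qed.

Lemma exists_max G : G != set0 -> exists2 g, g \in G & forall j, j \in G -> (j <= g)%N.
Proof.
case/set0Pn => i iG; exists [arg max_(j > i in G) (j : nat)]; by case: arg_maxnP.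
Qed.

Lemma signS k (x : int) : (-1) ^+ k.+1 * x = (-1) ^+ k * - x.
Proof. by rewrite exprS mulN1r mulNr mulrN. Qed.

Lemma nbc_sum_set0 r R : nbc_sum r set0 R = 1.
Proof.
rewrite /nbc_sum (big_pred1 set0) ?cards0 // => S; rewrite /nbc subset0 /=.
have [->|] := eqVneq S set0; last by [].
by rewrite -setI_eq0 set0I eqxx andbT; apply/forall_inP => j; rewrite inE.
Qed.

(** The largest element of [G], if it belongs to [R], is also the least element of some separator,
    which is therefore [[set g]]. *)
Lemma rank_isolated_max r G R g : rank_function r -> separator_minima r G R ->
  (forall j, j \in G -> (j <= g)%N) -> g \in R -> r [set g] != 0%N -> r G = (r (G :\ g)).+1.
Proof.
move=> rk RG gmax /RG[X [sX gX minX]] rg.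
have sg : separator r G [set g].
  suff <- : X = [set g] by [].
  apply/eqP; rewrite eqEsubset sub1set gX andbT.
  apply/subsetP => i iX; rewrite inE -val_eqE /= eqn_leq minX // andbT gmax //.
  by have /separatorP[/subsetP XG _] := sX; apply: XG.
case/separatorP: sg => _ <-; have := rank_le_card rk [set g]; rewrite cards1; lia.
Qed.

(** If [g] lies outside [R] and is neither a loop nor a coloop, deletion keeps the rank and
    contraction lowers it by one, which absorbs the minus sign of the recursion. If [g] is a nonloop
    in [R], the rank and [#|R|] both drop by one; hence [#|R|] in the exponent. Connectedness is not
    assumed, because the bound is applied to the minor that may fail to be connected. *)
Lemma nbc_sum_ge0 r G R : rank_function r -> R \subset G -> separator_minima r G R ->
  0 <= (-1) ^+ (r G + #|R|) * nbc_sum r G R.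
Proof.
move: {2}#|G| (leqnn #|G|) => m; elim: m r G R => [|m IHm] r G R.
  rewrite leqn0 cards_eq0 => /eqP-> rk; rewrite subset0 => /eqP->.
  by rewrite nbc_sum_set0 cards0 (rank_set0 rk).
have [->|/exists_max[g gG gmax]] := eqVneq G set0; first by move=> _; apply: IHm; rewrite cards0.
move=> Gm rk RG sR; have Ggm : (#|G :\ g| <= m)%N by have := cardsD1 g G; rewrite gG; lia.
have RGg : R :\ g \subset G :\ g by apply: setSD.
have del := IHm _ _ _ Ggm rk RGg (separator_minima_delete rk sR).
have con := IHm _ _ _ Ggm (contract_rank rk g) RGg (separator_minima_contract rk gG sR).
rewrite -nbc_sumD1 in del; rewrite -nbc_sumD1 in con.
have [rg|rg] := eqVneq (r [set g]) 0%N; first by rewrite (nbc_sum_loop _ gG rk rg) mulr0.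
rewrite (nbc_sum_rec R rk gG gmax) ?lt0n //; case: ifP => gR.
  rewrite subr0 (rank_isolated_max rk sR gmax gR rg) (cardsD1 g R) gR.
  by rewrite (_ : (true + #|R :\ g|)%N = #|R :\ g|.+1) // addSn addnS signS signS opprK.
move: del con; have -> : R :\ g = R by apply/setDidPl; rewrite disjoint_sym disjoints1 gR.
move=> del con.
have [rG|rG] := ltnP (r (G :\ g)) (r G); first by rewrite nbc_sum_coloop // subrr mulr0.
have rGE : r G = r (G :\ g) by have := rank_mono rk (subsetDl G [set g]); lia.
have rg1 : r [set g] = 1%N by have := rank_le_card rk [set g]; rewrite cards1; lia.
have rG0 : (0 < r G)%N by rewrite -rg1; apply: rank_mono; rewrite // sub1set.
rewrite mulrBr {1}rGE addr_ge0 //; move: con; rewrite /contract setD1K // rg1.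
by have -> : (r G + #|R| = (r G - 1 + #|R|).+1)%N; [lia | rewrite signS mulrN opprK].
Qed.

(** For [g] outside [R], the recursion writes the signed sum as two nonnegative terms, and a minor
    that still meets the hypotheses makes one of them positive. *)
Lemma nbc_sum_gt0 r G R : rank_function r -> R \subset G -> separator_minima r G R ->
  meets_separators r G R -> (forall x, x \in G -> r [set x] = 1%N) ->
  0 < (-1) ^+ (r G + #|R|) * nbc_sum r G R.
Proof.
move: {2}#|G| (leqnn #|G|) => m; elim: m r G R => [|m IHm] r G R.
  rewrite leqn0 cards_eq0 => /eqP-> rk; rewrite subset0 => /eqP->.
  by rewrite nbc_sum_set0 cards0 (rank_set0 rk).
have [->|/exists_max[g gG gmax]] := eqVneq G set0; first by move=> _; apply: IHm; rewrite cards0.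
move=> Gm rk RG sR mR r1; have Ggm : (#|G :\ g| <= m)%N by have := cardsD1 g G; rewrite gG; lia.
have RGg : R :\ g \subset G :\ g by apply: setSD.
have sRd := separator_minima_delete (g := g) rk sR.
have sRc := separator_minima_contract rk gG sR.
have r1d x : x \in G :\ g -> r [set x] = 1%N by rewrite inE => /andP[_ /r1].
have rg : r [set g] = 1%N by apply: r1.
rewrite (nbc_sum_rec R rk gG gmax) ?rg //; case: ifPn => gR.
  have rG := rank_isolated_max rk sR gmax gR; rewrite rg in rG; have {}rG := rG isT.
  rewrite subr0 rG (cardsD1 g R) gR nbc_sumD1.
  rewrite (_ : (true + #|R :\ g|)%N = #|R :\ g|.+1) // addSn addnS signS signS opprK; apply: IHm => // X.
  case/separatorP; rewrite subsetD1 => /andP[XG gX] rX X0.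
  have /mR/(_ X0)/set0Pn[i] : separator r G X.
    apply/separatorP; split=> //.
    have -> : G :\: X = g |: (G :\ g :\: X).
      by apply/setP => i; rewrite !inE; case: eqP => [->|_] /=; rewrite ?gX.
    by rewrite (rank_coloop rk gG) ?rG ?subsetDl // addnS rX.
  rewrite inE => /andP[iX iR]; apply/set0Pn; exists i; rewrite !inE iX iR andbT /=.
  by apply: contraNneq gX => <-.
have RE : R :\ g = R by apply/setDidPl; rewrite disjoint_sym disjoints1.
rewrite RE in RGg sRd sRc.
have rGE : r G = r (G :\ g) by rewrite (not_coloop rk mR gG gR).
have rG0 : (0 < r G)%N by rewrite -rg; apply: rank_mono; rewrite // sub1set.
have rGc : contract r g (G :\ g) = (r G).-1 by rewrite /contract setD1K // rg subn1.
have -> : (-1) ^+ (r G + #|R|) * (nbc_sum r (G :\ g) R - nbc_sum (contract r g) (G :\ g) R) =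
    (-1) ^+ (r (G :\ g) + #|R|) * nbc_sum r (G :\ g) R +
    (-1) ^+ (contract r g (G :\ g) + #|R|) * nbc_sum (contract r g) (G :\ g) R.
  rewrite mulrBr -rGE rGc; congr (_ + _).
  by have -> : (r G + #|R| = ((r G).-1 + #|R|).+1)%N; [lia | rewrite signS mulrN opprK].
have del0 := nbc_sum_ge0 rk RGg sRd.
have con0 := nbc_sum_ge0 (contract_rank rk g) RGg sRc.
suff [del|[con c1]] : meets_separators r (G :\ g) R \/
    meets_separators (contract r g) (G :\ g) R /\
    (forall x, x \in G :\ g -> contract r g [set x] = 1%N).
- by apply: ltr_wpDr => //; apply: IHm.
- by apply: ltr_wpDl => //; apply: IHm => //; apply: contract_rank.
have [|con] := delete_or_contract rk mR gG gR; first by left.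
(* The induction also asks for a matroid without loops. If contracting [g] creates a loop, the
   deletion is used instead. *)
have [/existsP[x /andP[xG /eqP cx]]|none] :=
  boolP [exists x, (x \in G :\ g) && (contract r g [set x] == 0%N)]; last first.
  right; split=> // x xG; have /existsPn/(_ x) := none; rewrite xG /=.
  have := rank_le_card (contract_rank rk g) [set x]; rewrite cards1; lia.
(* The loop [x] of the contraction is parallel to [g] and lies in [R]. A separator of the deletion
   that avoids [R] misses [x], so adding [g] to its complement does not change the rank, and it
   would separate [G] as well. *)
left=> X /separatorP[XG rX] X0; apply/negP => /eqP XR.
have xR : x \in R.
  have /con : separator (contract r g) (G :\ g) [set x].
    apply/separatorP; rewrite sub1set; split=> //.
    have := rank_setU (contract_rank rk g) [set x] (G :\ g :\ x).
    have := rank_mono (contract_rank rk g) (subsetDl (G :\ g) [set x]).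
    by rewrite setD1K // cx; lia.
  case/(_ _)/set0Pn => [|i]; first by apply/set0Pn; exists x; rewrite set11.
  by rewrite !inE => /andP[/eqP->].
have : separator r G X.
  move: XG; rewrite subsetD1 => /andP[XG gX]; apply/separatorP; split=> //.
  have -> : G :\: X = g |: (G :\ g :\: X).
    by apply/setP => i; rewrite !inE; case: eqP => [->|_] /=; rewrite ?gX.
  rewrite (closure_mono rk (A := [set x])) ?rX -?rGE //.
    rewrite sub1set inE xG andbT; apply: contraTN isT => xX.
    by have /setP/(_ x) := XR; rewrite !inE xX xR.
  rewrite r1d //; move: cx; rewrite /contract rg.
  by have := rank_mono rk (subsetUl [set g] [set x]); rewrite rg; lia.
by move/mR/(_ X0); rewrite XR eqxx.
Qed.

End NBCSign.

(** * Connected components of a matroid *)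

Section MatroidRank.
Variables (n : nat) (M : matroid n).
Implicit Types (A B C I S X Z : {set 'I_n}) (x y m : 'I_n).

Definition matroid_rank X : nat := \max_(I in indep M | I \subset X) #|I|.

Local Notation r := matroid_rank.

Lemma matroid_rank_ge I X : I \in indep M -> I \subset X -> #|I| <= r X.
Proof.
move=> iI IX; rewrite /matroid_rank (bigD1 I) ?iI //=; exact: leq_maxl.
Qed.

Lemma basis_extend I X : I \in indep M -> I \subset X ->
  exists B, [/\ I \subset B, B \subset X, B \in indep M & #|B| = r X].
Proof.
move: {2}(r X - #|I|) (leqnn (r X - #|I|)) => d; elim: d I => [|d IHd] I rI iI IX.
  by exists I; split=> //; have := matroid_rank_ge iI IX; lia.
have [B0 /andP[iB BX] rB] : {B | (B \in indep M) && (B \subset X) & r X = #|B|}.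
  by apply: eq_bigmax_cond; apply/card_gt0P; exists set0; rewrite unfold_in /= indep0 sub0set.
have [lt_IB|le_BI] := ltnP #|I| #|B0|; last first.
  by exists I; split=> //; have := matroid_rank_ge iI IX; lia.
have [x] := indep_exchange iI iB lt_IB; rewrite inE => /andP[xI xB] ixI.
have [|||B [IB BX' iB' rB']] := IHd (x |: I) => //.
- by rewrite cardsU1 xI; lia.
- by rewrite subUset sub1set (subsetP BX).
by exists B; split=> //; apply: subset_trans IB; rewrite subsetUr.
Qed.

Lemma matroid_rank_le_card X : r X <= #|X|.
Proof. by apply/bigmax_leqP => I /andP[_]; apply: subset_leq_card. Qed.

Lemma matroid_rankP : rank_function r.
Proof.
split=> [|A B AB|A B]; first exact: matroid_rank_le_card.
  apply/bigmax_leqP => I /andP[iI IA]; apply: matroid_rank_ge => //.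
  exact: subset_trans AB.
(* For submodularity, a basis [I] of [A :&: B] is extended to a basis [U] of [A :|: B], and
   [U :&: A] and [U :&: B] are counted. *)
have [I [_ IAB iI rI]] := basis_extend (indep0 M) (sub0set (A :&: B)).
have IABU : I \subset A :|: B.
  by apply: subset_trans IAB _; rewrite subIset // subsetUl.
have [U [IU UAB iU rU]] := basis_extend iI IABU.
have UA : #|U :&: A| <= r A by apply: matroid_rank_ge; rewrite ?subsetIr // (indep_sub (subsetIl _ _) iU).
have UB : #|U :&: B| <= r B by apply: matroid_rank_ge; rewrite ?subsetIr // (indep_sub (subsetIl _ _) iU).
have := cardsUI (U :&: A) (U :&: B); rewrite -setIUr (setIidPl UAB) -setIIr.
have : #|I| <= #|U :&: (A :&: B)| by apply: subset_leq_card; rewrite subsetI IU.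
lia.
Qed.

Lemma indepE S : (S \in indep M) = (r S == #|S|).
Proof.
apply/idP/eqP => [iS|rS].
  by apply/eqP; rewrite eqn_leq matroid_rank_le_card matroid_rank_ge.
have [B [_ BS iB rB]] := basis_extend (indep0 M) (sub0set S).
have /eqP <- // : B == S by rewrite eqEcard BS rB rS leqnn.
Qed.

Lemma dependentE S : dependent M S = (r S < #|S|).
Proof. by rewrite /dependent indepE ltn_neqAle matroid_rank_le_card andbT. Qed.

Lemma rank_circuit_circuit C : rank_circuit r C -> circuit M C.
Proof.
case/and3P=> C0 /eqP rC /forall_inP rCx; apply/minsetP; split=> [|D dD DC].
  by rewrite dependentE -rC.
apply/eqP; rewrite eqEsubset DC; apply: contraLR dD => /subsetPn[x xC xD].
rewrite negbK; have DCx : D \subset C :\ x by rewrite subsetD1 DC.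
apply: indep_sub DCx _; rewrite indepE (eqP (rCx x xC)).
by have := cardsD1 x C; rewrite xC -rC; lia.
Qed.

(** Otherwise both parts of [C] are proper, hence independent, and additivity of the rank along [X]
    would make [C] independent. *)
Lemma circuit_separator C X : circuit M C -> separator r setT X ->
  C :&: X != set0 -> C \subset X.
Proof.
move=> /minsetP[dC minC] sX CX0; rewrite -setD_eq0; apply: contraTT dC => CX1.
have proper A : A \subset C -> A != C -> r A = #|A|.
  move=> AC neq; apply/eqP; rewrite -indepE; apply: contraNT neq => dA.
  by apply/eqP/minC.
rewrite dependentE (separator_split matroid_rankP sX (subsetT C)) !proper ?subsetIl ?subsetDl //.
- by rewrite cardsID ltnn.
- apply: contraNneq CX0 => CE; rewrite -CE.
  by apply/eqP/setP => i; rewrite !inE; case: (i \in C); case: (i \in X).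
- apply: contraNneq CX1 => CE; rewrite -CE.
  by apply/eqP/setP => i; rewrite !inE; case: (i \in C); case: (i \in X).
Qed.

(** The description by separators gives access to the rank lemmas; [connected_eltsE] identifies it
    with the relation given by circuits. *)
Definition component x : {set 'I_n} := \bigcap_(Z | separator r setT Z && (x \in Z)) Z.

Lemma mem_component x : x \in component x.
Proof. by apply/bigcapP => Z /andP[]. Qed.

Lemma component_min x Z : separator r setT Z -> x \in Z -> component x \subset Z.
Proof. by move=> sZ xZ; apply: bigcap_inf; rewrite sZ. Qed.

Lemma component_separator x : separator r setT (component x).
Proof.
rewrite /component; elim/big_ind: _ => [|A B sA sB|Z /andP[]//].
  by apply/separatorP; rewrite subxx setDv (rank_set0 matroid_rankP) addn0.
exact: (separatorI matroid_rankP).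
Qed.

(** Removing from the component a separator that misses [x] would leave a smaller separator of the
    whole matroid containing [x]. *)
Lemma component_connected x : meets_separators r (component x) [set x].
Proof.
move=> Z sZ Z0; apply/set0Pn; exists x; rewrite !inE eqxx andbT.
apply: contraNT Z0 => xZ; have sX := component_separator x.
have /separatorP[XT rX] := sX; have /separatorP[ZX rZ] := sZ.
have : component x \subset component x :\: Z.
  apply: component_min; last by rewrite inE xZ mem_component.
  apply/separatorP; split; first exact: subsetT.
  have := rank_setU matroid_rankP (component x :\: Z) ([set: 'I_n] :\: (component x :\: Z)).
  have := rank_setU matroid_rankP Z ([set: 'I_n] :\: component x).
  have -> : Z :|: ([set: 'I_n] :\: component x) = [set: 'I_n] :\: (component x :\: Z).
    apply/setP => i; rewrite !inE; have /implyP := subsetP ZX i.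
    by case: (i \in Z); case: (i \in component x).
  have -> : (component x :\: Z) :|: ([set: 'I_n] :\: (component x :\: Z)) = setT.
    by apply/setP => i; rewrite !inE; case: (i \in Z); case: (i \in component x).
  lia.
move=> sub; rewrite -subset0; apply/subsetP => i iZ.
by have := subsetP sub i (subsetP ZX i iZ); rewrite inE iZ.
Qed.

Lemma connected_eltsE x y : connected_elts M x y = (y \in component x).
Proof.
apply/orP/idP => [[/eqP<-|/existsP[C /and3P[cC xC yC]]]|yX].
- exact: mem_component.
- apply/bigcapP => Z /andP[sZ xZ]; apply: subsetP yC; apply: circuit_separator => //.
  by apply/set0Pn; exists x; rewrite inE xC.
have [|xy] := eqVneq x y; [by left | right].
have [C [_ cC xC yC]] := common_circuit matroid_rankP (@component_connected x) (mem_component x) yX xy.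
by apply/existsP; exists C; rewrite rank_circuit_circuit // xC.
Qed.

Lemma component_sym x y : (y \in component x) = (x \in component y).
Proof.
rewrite -!connected_eltsE /connected_elts eq_sym; congr (_ || _).
by apply: eq_existsb => C; rewrite [(x \in C) && _]andbC.
Qed.

Lemma component_eq x y : y \in component x -> component y = component x.
Proof.
move=> yx; apply/eqP; rewrite eqEsubset !component_min ?component_separator //.
by rewrite component_sym.
Qed.

Definition component_minima : {set 'I_n} :=
  [set x | [forall y in component x, (x <= y)%N]].

Lemma component_minimaP x :
  exists2 m, m \in component_minima & component m = component x.
Proof.
have X0 : component x != set0 by apply/set0Pn; exists x; apply: mem_component.
pose m := [arg min_(j < x in component x) (j : nat)].
have [mX minm] : m \in component x /\ forall j, j \in component x -> m <= j.
  by rewrite /m; case: arg_minnP => //; apply: mem_component.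
exists m; last exact: component_eq.
by rewrite inE (component_eq mX); apply/forall_inP.
Qed.

Lemma component_inj : {in component_minima &, injective component}.
Proof.
move=> x y; rewrite !inE => /forall_inP xmin /forall_inP ymin xy.
apply/val_inj/eqP; rewrite /= eqn_leq xmin ?ymin //; last by rewrite xy mem_component.
by rewrite -xy mem_component.
Qed.

Lemma card_connected_components : #|connected_components M| = #|component_minima|.
Proof.
rewrite -(card_in_imset component_inj); congr #|pred_of_set _|; apply/setP => X.
apply/imsetP/imsetP => -[x xR ->].
  have [m mR mx] := component_minimaP x; exists m => //.
  by rewrite mx; apply/setP => y; rewrite !inE connected_eltsE.
by exists x; rewrite ?inE //; apply/setP => y; rewrite !inE connected_eltsE.
Qed.

Lemma component_minima_separator : separator_minima r setT component_minima.
Proof.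
move=> m; rewrite inE => /forall_inP minm; exists (component m).
by rewrite component_separator mem_component.
Qed.

Lemma component_minima_meets : meets_separators r setT component_minima.
Proof.
move=> X sX /set0Pn[x xX]; have [m mR mx] := component_minimaP x.
apply/set0Pn; exists m; rewrite inE mR andbT.
by apply: (subsetP (component_min sX xX)); rewrite -mx mem_component.
Qed.

Lemma loopless_rank x : loopless M -> r [set x] = 1.
Proof.
move=> /(_ x); rewrite /loop dependentE cards1 -leqNgt.
by have := matroid_rank_le_card [set x]; rewrite cards1; lia.
Qed.

End MatroidRank.

(** * Contractions of the exterior algebra *)

Section Contraction.
Variables (K : fieldType) (n : nat).
Local Notation E := (exterior K n).
Local Notation gen := (@ext_gen K n).
Implicit Types (S T : {set 'I_n}) (i j k : 'I_n) (x y z v w : E) (lam mu : 'I_n -> K).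
Local Open Scope ring_scope.

Definition below S i : nat := #|[set j in S | (j < i)%N]|.

Lemma below_setU1 S i k : k \notin S -> below (k |: S) i = ((k < i) + below S i)%N.
Proof.
move=> kS; rewrite /below; case: ltnP => ki.
  have -> : [set j in k |: S | (j < i)%N] = k |: [set j in S | (j < i)%N].
    by apply/setP => j; rewrite !inE; case: eqP => [->|].
  by rewrite cardsU1 inE (negPf kS).
congr #|pred_of_set _|; apply/setP => j; rewrite !inE; case: eqP => [->|] //=.
by rewrite ltnNge ki andbF.
Qed.

Lemma inversions_set1 i T : inversions [set i] T = below T i.
Proof.
rewrite /inversions big_set1 /below -sum1_card (big_setID [set j : 'I_n | (j < i)%N]) /=.
rewrite [X in (_ + X)%N]big1 ?addn0 => [|j].
  apply: eq_big => [j|j]; rewrite !inE // => /andP[_ ->] //.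
by rewrite !inE => /andP[/negPf->].
Qed.

Lemma gen_mulE i x S :
  (gen i * x) S = if i \in S then (-1) ^+ below S i * x (S :\ i) else 0.
Proof.
rewrite [LHS]ffunE; case: ifP => iS.
  rewrite (bigD1 [set i]) ?sub1set //= big1 ?addr0 => [|T /andP[_ /negPf Ti]].
    rewrite ffunE eqxx mul1r inversions_set1; congr (_ ^+ _ * _).
    by rewrite -{2}(setD1K iS) below_setU1 ?setD11 // ltnn.
  by rewrite ffunE Ti mul0r mulr0.
rewrite big1 // => T TS; rewrite ffunE; case: eqP => [Ti|]; last by rewrite mul0r mulr0.
by move: TS; rewrite Ti sub1set iS.
Qed.

Lemma basis_sum x : x = \sum_S x S *: ext_basis K S.
Proof.
apply/ffunP => T; rewrite sum_ffunE (bigD1 T) //= big1 ?addr0 => [|S /negPf TS].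
  by rewrite !ffunE eqxx /GRing.scale /= mulr1.
by rewrite !ffunE eq_sym TS scaler0.
Qed.

(** Reduces identities between linear operators to the unit and to left multiplication by a
    generator, so that signs are computed only once per operator. *)
Lemma exterior_ind (P : E -> Prop) :
  (forall (a : K) x y, P x -> P y -> P (a *: x + y)) -> P 0 -> P 1 ->
  (forall i x, P x -> P (gen i * x)) -> forall x, P x.
Proof.
move=> Plin P0 P1 Pgen x; rewrite [x]basis_sum.
elim/big_ind: _ => // [y z Py Pz|S _]; first by rewrite -[y]scale1r; apply: Plin.
rewrite -[_ *: _]addr0; apply: Plin => //; rewrite ext_basisE.
by elim: (enum S) => [|i s IHs]; rewrite ?big_nil // big_cons; apply: Pgen.
Qed.

(* Interior multiplication by the linear form e_i |-> lam i. *)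
Definition contraction lam x : E :=
  [ffun S : {set 'I_n} =>
    \sum_(k | k \notin S) lam k * ((-1) ^+ below S k * x (k |: S))].

Lemma contraction_is_linear lam : linear (contraction lam).
Proof.
move=> a x y; apply/ffunP => S; rewrite !ffunE scaler_sumr -big_split /=.
by apply: eq_bigr => k _; rewrite !ffunE /GRing.scale /=; ring.
Qed.

HB.instance Definition _ lam :=
  GRing.isLinear.Build K E E _ (contraction lam) (@contraction_is_linear lam).

(** The grading involution: it records the sign of moving an element of degree one past [x]. *)
Definition parity x : E := [ffun S : {set 'I_n} => (-1) ^+ #|S| * x S].

Lemma parity_is_linear : linear parity.
Proof. by move=> a x y; apply/ffunP => S; rewrite !ffunE /GRing.scale /=; ring. Qed.

HB.instance Definition _ := GRing.isLinear.Build K E E _ parity parity_is_linear.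

Lemma contraction1 lam : contraction lam 1 = 0.
Proof.
apply/ffunP => S; rewrite !ffunE big1 // => k _; rewrite ffunE (_ : _ == _ = false) ?mulr0 //.
by apply/eqP => /setP/(_ k); rewrite !inE eqxx.
Qed.

Lemma parity1 : parity 1 = 1.
Proof.
apply/ffunP => S; rewrite !ffunE; case: eqP => [->|]; last by rewrite mulr0.
by rewrite cards0 mul1r.
Qed.

Lemma parity_gen i x : parity (gen i * x) = - (gen i * parity x).
Proof.
apply/ffunP => S; rewrite [LHS]ffunE [RHS]ffunE !gen_mulE [parity x _]ffunE.
case: ifP => iS; last by rewrite mulr0 oppr0.
by rewrite (cardsD1 i S) iS exprS; ring.
Qed.

Lemma sign_mulK (b : nat) (a : K) : (-1) ^+ b * ((-1) ^+ b * a) = a.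
Proof. by rewrite mulrA -exprD addnn -signr_odd odd_double mul1r. Qed.

(** This is the only place where the signs of a contraction are compared with those of the product;
    the rules for products, squares and anticommutation follow by [exterior_ind]. *)
Lemma contraction_gen lam i x :
  contraction lam (gen i * x) = lam i *: x - gen i * contraction lam x.
Proof.
apply/ffunP => S; rewrite [LHS]ffunE [RHS]ffunE [X in _ = X + _]ffunE [X in _ = _ + X]ffunE gen_mulE.
rewrite /GRing.scale /=; case: ifPn => iS; last first.
  rewrite (bigD1 i) //= big1 ?addr0 => [|k /andP[kS ki]]; last first.
    by rewrite gen_mulE !inE eq_sym (negPf ki) (negPf iS) !mulr0.
  by rewrite gen_mulE setU11 setU1K // below_setU1 // ltnn sign_mulK subr0.
rewrite ffunE (bigD1 i (P := fun k => k \notin S :\ i)) ?inE ?eqxx //=.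
rewrite (setD1K iS) mulrDr.
have -> : (-1) ^+ below S i * (lam i * ((-1) ^+ below (S :\ i) i * x S)) = lam i * x S.
  rewrite -{1}(setD1K iS) below_setU1 ?setD11 // ltnn.
  by rewrite mulrCA sign_mulK.
rewrite opprD addrA subrr sub0r mulr_sumr -sumrN.
apply: eq_big => [k|k kS]; first by rewrite !inE; case: eqP => [->|_] /=; rewrite ?iS ?andbT.
have ki : k != i by apply: contraNneq kS => ->.
rewrite gen_mulE !inE iS orbT; have kSi : k \notin S :\ i by rewrite inE (negPf kS) andbF.
have -> : (k |: S) :\ i = k |: S :\ i.
  by apply/setP => j; rewrite !inE; case: eqP => [->|] //=; rewrite eq_sym (negPf ki).
have belowSk : below S k = ((i < k) + below (S :\ i) k)%N.
  by rewrite -{1}(setD1K iS) below_setU1 ?setD11.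
rewrite below_setU1 // belowSk !exprD.
(* Exactly one of the two comparisons holds, which produces the minus sign of the antiderivation
   rule. *)
have : ((k < i) + (i < k) = 1)%N by have := val_eqE k i; rewrite (negPf ki) /= => /eqP; lia.
by case: (k < i)%N; case: (i < k)%N => //= _; ring.
Qed.

Lemma gen_sq i : gen i * gen i = 0.
Proof. by rewrite /ext_gen ext_basisM disjoints1 set11. Qed.

Lemma gen_anticomm i j : gen i * gen j = - (gen j * gen i).
Proof.
have [->|ij] := eqVneq i j; first by rewrite gen_sq oppr0.
rewrite /ext_gen !ext_basisM !disjoints1 !inE [j == i]eq_sym (negPf ij) /= setUC !inversions_set1.
have b k l : below [set k] l = (k < l)%N :> nat.
  by rewrite -[[set k]]setU0 below_setU1 ?inE // /below (_ : [set _ in _ | _] = set0) ?cards0 ?addn0 //;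
    apply/setP => m; rewrite !inE.
rewrite !b; have : ((i < j) + (j < i) = 1)%N by have := val_eqE i j; rewrite (negPf ij) /= => /eqP; lia.
by case: (i < j)%N; case: (j < i)%N => //= _; rewrite ?expr0 ?expr1 ?scale1r ?scaleN1r ?opprK.
Qed.

Lemma mul_gen x i : x * gen i = gen i * parity x.
Proof.
elim/exterior_ind: x => [a x y Px Py|||j x Px].
- by rewrite mulrDl -scalerAl Px Py linearP mulrDr -scalerAr.
- by rewrite mul0r linear0 mulr0.
- by rewrite mul1r parity1 mulr1.
- by rewrite -mulrA Px mulrA gen_anticomm parity_gen mulrN mulrA mulNr.
Qed.

Definition form_eval lam v : K := \sum_i lam i * v [set i].

Lemma homog1E v : ext_homog 1 v -> v = \sum_i v [set i] *: gen i.
Proof.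
move=> hv; apply/ffunP => S; rewrite sum_ffunE.
have [/cards1P[i ->]|S1] := boolP (#|S| == 1%N).
  rewrite (bigD1 i) //= big1 ?addr0 => [|j ji]; rewrite !ffunE.
    by rewrite eqxx /GRing.scale /= mulr1.
  by rewrite (inj_eq set1_inj) eq_sym (negPf ji) scaler0.
rewrite big1 => [|i _]; first by apply/eqP; apply: contraNT S1 => /hv h; apply/eqP.
by rewrite !ffunE; case: (S =P [set i]) S1 => [->|]; rewrite ?cards1 // scaler0.
Qed.

Lemma homog1_gen i : ext_homog 1 (gen i).
Proof. by move=> S; rewrite ffunE; case: (S =P [set i]) => [->|]; rewrite ?cards1 ?eqxx. Qed.

Lemma homog1_linear (a : K) v w : ext_homog 1 v -> ext_homog 1 w -> ext_homog 1 (a *: v + w).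
Proof.
move=> hv hw S; have [vS|/hv//] := eqVneq (v S) 0.
have [wS|/hw//] := eqVneq (w S) 0.
by rewrite !ffunE vS wS scaler0 addr0 eqxx.
Qed.

Lemma homog1_sum (I : Type) (s : seq I) (F : I -> E) :
  (forall a, ext_homog 1 (F a)) -> ext_homog 1 (\sum_(a <- s) F a).
Proof.
move=> hF; elim/big_ind: _ => // [S|v w hv hw]; first by rewrite ffunE eqxx.
by rewrite -[v]scale1r; apply: homog1_linear.
Qed.

Lemma form_evalE lam v : contraction lam v set0 = form_eval lam v.
Proof.
rewrite ffunE /form_eval; apply: eq_big => [k|k _]; rewrite ?inE // setU0.
by rewrite (_ : below set0 k = 0%N) ?expr0 ?mul1r //; apply/eqP; rewrite cards_eq0;
  apply/eqP/setP => j; rewrite !inE.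
Qed.

Lemma form_eval_linear lam (a : K) v w :
  form_eval lam (a *: v + w) = a * form_eval lam v + form_eval lam w.
Proof. by rewrite -!form_evalE linearP !ffunE. Qed.

Lemma form_eval_gen lam i : form_eval lam (gen i) = lam i.
Proof.
rewrite /form_eval (bigD1 i) //= big1 ?addr0 => [|j ji]; rewrite ffunE ?eqxx ?mulr1 //.
by rewrite (inj_eq set1_inj) (negPf ji) mulr0.
Qed.

Lemma contraction_homog1 lam v x : ext_homog 1 v ->
  contraction lam (v * x) = form_eval lam v *: x - v * contraction lam x.
Proof.
move/homog1E=> {1 3}->; rewrite !mulr_suml linear_sum /form_eval scaler_suml -sumrB.
apply: eq_bigr => i _; rewrite -!scalerAl linearZ /= contraction_gen scalerBr scalerA.
by rewrite mulrC.
Qed.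

Lemma mul_homog1 x v : ext_homog 1 v -> x * v = v * parity x.
Proof.
move/homog1E=> ->; rewrite mulr_sumr mulr_suml; apply: eq_bigr => i _.
by rewrite -scalerAr mul_gen scalerAl.
Qed.

Lemma parity_homog1 v : ext_homog 1 v -> parity v = - v.
Proof.
move=> hv; apply/ffunP => S; rewrite !ffunE; have [->|/hv->] := eqVneq (v S) 0.
  by rewrite mulr0 oppr0.
by rewrite mulN1r.
Qed.

Lemma homog1_anticomm v w : ext_homog 1 v -> ext_homog 1 w -> v * w = - (w * v).
Proof. by move=> hv hw; rewrite mul_homog1 // parity_homog1 // mulrN. Qed.

(** Anticommutation does not give this in characteristic two, so the square is expanded in the
    generators. *)
Lemma homog1_sq v : ext_homog 1 v -> v * v = 0.
Proof.
move/homog1E=> ->; elim: (index_enum _) => [|i s IHs]; first by rewrite big_nil mul0r.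
rewrite big_cons mulrDl !mulrDr IHs addr0 -scalerAl -scalerAr gen_sq !scaler0 add0r.
rewrite (mul_homog1 (v [set i] *: gen i)).
  by rewrite linearZ /= parity_homog1 ?scalerN ?mulrN ?addNr //; apply: homog1_gen.
apply: homog1_sum => j; rewrite -[_ *: _]addr0; apply: homog1_linear; first exact: homog1_gen.
by move=> S; rewrite ffunE eqxx.
Qed.

Lemma contractionM lam x y :
  contraction lam (x * y) = contraction lam x * y + parity x * contraction lam y.
Proof.
elim/exterior_ind: x => [a x z Px Pz|||j x Px].
- by rewrite mulrDl -scalerAl !linearP /= Px Pz scalerDr !mulrDl -!scalerAl addrACA.
- by rewrite mul0r !linear0 ?mul0r addr0.
- by rewrite contraction1 parity1 mul0r !mul1r add0r.
- by rewrite -mulrA !contraction_gen Px parity_gen mulrDr mulrBl -scalerAl opprD !mulrA mulNr addrA.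
Qed.

Lemma contraction_anticomm lam mu x :
  contraction lam (contraction mu x) = - contraction mu (contraction lam x).
Proof.
elim/exterior_ind: x => [a x y Px Py|||i x Px].
- by rewrite !linearP /= Px Py.
- by rewrite !linear0.
- by rewrite !contraction1 !linear0 ?oppr0.
- rewrite !contraction_gen !linearB !linearZ /= !contraction_gen Px mulrN opprK.
  by rewrite scalerN opprK opprD !addrA [- (lam i *: _) + _]addrC.
Qed.

Lemma contraction_sq lam x : contraction lam (contraction lam x) = 0.
Proof.
elim/exterior_ind: x => [a x y Px Py|||i x Px].
- by rewrite !linearP /= Px Py scaler0 addr0.
- by rewrite !linear0.
- by rewrite !contraction1 !linear0.
- by rewrite contraction_gen linearB linearZ /= contraction_gen Px mulr0 subr0 subrr.
Qed.

Lemma contraction_basis lam S : contraction lam (ext_basis K S) =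
  \sum_(i in S) (lam i * (-1) ^+ below S i) *: ext_basis K (S :\ i).
Proof.
apply/ffunP => T; rewrite ffunE sum_ffunE.
rewrite (bigID (fun k => k |: T == S)) /= [X in _ + X]big1 ?addr0; last first.
  by move=> k /andP[_ /negPf kT]; rewrite ffunE kT !mulr0.
rewrite [RHS](bigID (fun k => S :\ k == T)) /= [X in _ = _ + X]big1 ?addr0; last first.
  by move=> k /andP[_ /negPf kT]; rewrite !ffunE eq_sym kT scaler0.
apply: eq_big => [k|k /andP[kT /eqP kTS]].
  apply/andP/andP => -[kT /eqP <-]; first by rewrite setU11 setU1K.
  by rewrite setD11 setD1K.
by rewrite !ffunE -kTS setU1K // !eqxx below_setU1 // ltnn /GRing.scale /= !mulr1.
Qed.

(** The boundary is thus one of the contractions and anticommutes with all of them. *)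
Lemma boundaryE S : boundary K S = contraction (fun=> 1) (ext_basis K S).
Proof. by rewrite contraction_basis; apply: eq_bigr => i _; rewrite mul1r. Qed.

End Contraction.

(** * Regularity modulo an ideal *)

Section Ideals.
Variables (K : fieldType) (n : nat).
Local Notation E := (exterior K n).
Local Notation gen := (@ext_gen K n).
Implicit Types (S T X : {set 'I_n}) (i j k : 'I_n) (a b x y z v w : E) (lam mu : 'I_n -> K).
Implicit Types (I : E -> Prop).
Local Open Scope ring_scope.

Lemma parityM x y : parity (x * y) = parity x * parity y.
Proof.
elim/exterior_ind: x => [c x z Px Pz|||i x Px].
- by rewrite mulrDl -scalerAl !linearP /= Px Pz mulrDl -scalerAl.
- by rewrite mul0r !linear0 mul0r.
- by rewrite mul1r parity1 mul1r.
- by rewrite -mulrA !parity_gen Px mulNr mulrA.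
Qed.

Lemma parity_contraction lam x : parity (contraction lam x) = - contraction lam (parity x).
Proof.
elim/exterior_ind: x => [c x z Px Pz|||i x Px].
- by rewrite !linearP /= Px Pz ?scalerN ?opprD.
- by rewrite !linear0.
- by rewrite parity1 contraction1 linear0 ?oppr0.
- by rewrite parity_gen linearN /= !contraction_gen linearB linearZ /= parity_gen Px mulrN !opprK.
Qed.

Lemma parity_basis S : parity (ext_basis K S) = (-1) ^+ #|S| *: ext_basis K S.
Proof.
apply/ffunP => T; rewrite !ffunE; case: (T =P S) => [->|] //.
by rewrite mulr0 scaler0.
Qed.

Lemma ideal_lin I (c : K) x y : two_sided_ideal I -> I x -> I y -> I (c *: x + y).
Proof.
case=> _ ID IM Ix Iy; apply: ID => //.
by rewrite -[x]mul1r scalerAl; apply: (IM _ _ Ix).1.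
Qed.

Lemma ideal_scale I (c : K) x : two_sided_ideal I -> I x -> I (c *: x).
Proof.
by move=> iI Ix; rewrite -[_ *: _]addr0; apply: ideal_lin => //; case: iI.
Qed.

Lemma idealB I x y : two_sided_ideal I -> I x -> I y -> I (x - y).
Proof. by move=> iI Ix Iy; rewrite addrC -scaleN1r; apply: ideal_lin. Qed.

Lemma ideal_sum I (J : finType) (P : pred J) (F : J -> E) :
  two_sided_ideal I -> (forall l, P l -> I (F l)) -> I (\sum_(l | P l) F l).
Proof. by case=> I0 ID _ IF; elim/big_ind: _. Qed.

(** Right multiples of [v] suffice: for [v] of degree one, [a * v = v * parity a], so over a
    two-sided [I] this is again a two-sided ideal. *)
Definition ideal_add I v : E -> Prop := fun x => exists y, I (x - v * y).

Definition ideal_adds I (vs : seq E) : E -> Prop := foldl ideal_add I vs.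

(* 0 :_N v = v N for the left module N = E / I. *)
Definition regular_mod I v : Prop := forall x, I (v * x) -> ideal_add I v x.

Lemma ideal_add_sub I v x : I x -> ideal_add I v x.
Proof. by exists 0; rewrite mulr0 subr0. Qed.

Lemma ideal_add_mul I v x : two_sided_ideal I -> ideal_add I v (v * x).
Proof. by case=> I0 _ _; exists x; rewrite subrr. Qed.

Lemma ideal_add_ideal I v : two_sided_ideal I -> ext_homog 1 v ->
  two_sided_ideal (ideal_add I v).
Proof.
move=> iI hv; have [I0 ID IM] := iI; split.
- exact: ideal_add_sub.
- move=> x y [s xs] [t yt]; exists (s + t).
  by rewrite mulrDr opprD addrACA; apply: ID.
- move=> a x [s xs]; split; [exists (parity a * s) | exists (s * a)].
    by rewrite mulrA -mul_homog1 // -mulrA -mulrBr; apply: (IM _ _ xs).1.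
  by rewrite mulrA -mulrBl; apply: (IM _ _ xs).2.
Qed.

Lemma ideal_adds_ideal I vs : two_sided_ideal I -> (forall v, v \in vs -> ext_homog 1 v) ->
  two_sided_ideal (ideal_adds I vs).
Proof.
elim/last_ind: vs => // vs v IHvs iI hv; rewrite /ideal_adds -cats1 foldl_cat /=.
apply: ideal_add_ideal; last by apply: hv; rewrite mem_rcons mem_head.
by apply: IHvs => // u uvs; apply: hv; rewrite mem_rcons inE uvs orbT.
Qed.

Lemma ideal_adds_rcons I vs v : ideal_adds I (rcons vs v) = ideal_add (ideal_adds I vs) v.
Proof. by rewrite /ideal_adds -cats1 foldl_cat. Qed.

Lemma ideal_adds_sub I vs x : I x -> ideal_adds I vs x.
Proof.
by elim/last_ind: vs => // vs v IHvs Ix; rewrite ideal_adds_rcons; apply/ideal_add_sub/IHvs.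
Qed.

Lemma ideal_adds_mem I vs v : two_sided_ideal I -> (forall v, v \in vs -> ext_homog 1 v) ->
  v \in vs -> ideal_adds I vs v.
Proof.
elim/last_ind: vs => // vs u IHvs iI hv; rewrite mem_rcons inE ideal_adds_rcons.
have hv' w : w \in vs -> ext_homog 1 w by move=> wvs; apply: hv; rewrite mem_rcons inE wvs orbT.
case/orP => [/eqP->|/IHvs h]; last by apply: ideal_add_sub; apply: h.
by have := @ideal_add_mul (ideal_adds I vs) u 1; rewrite mulr1; apply; apply: ideal_adds_ideal.
Qed.

(** Modulo [I], regularity of [w] gives [x = w y + v z]. Then [v w z] vanishes, so [z = w p + v q]
    by both regularities, and [v z = - w v p] because [v v = 0]. *)
Lemma regular_mod_descend I v w : two_sided_ideal I -> ext_homog 1 v -> ext_homog 1 w ->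
  regular_mod I v -> regular_mod (ideal_add I v) w -> regular_mod I w.
Proof.
move=> iI hv hw vreg wreg x wx; have [_ ID IM] := iI.
have [y [z xyz]] := wreg x (ideal_add_sub v wx).
have /vreg wz : I (v * (w * z)).
  rewrite mulrA (homog1_anticomm hv hw) mulNr -mulrA.
  suff -> : - (w * (v * z)) = w * (x - w * y - v * z) - w * x.
    by apply: idealB => //; apply: (IM _ _ xyz).1.
  by rewrite !mulrBr [w * (w * y)]mulrA homog1_sq // mul0r subr0 addrAC subrr sub0r.
have [p [q zpq]] := wreg z wz.
exists (y - v * p); suff -> : x - w * (y - v * p) = (x - w * y - v * z) + v * (z - w * p - v * q).
  by apply: ID => //; apply: (IM _ _ zpq).1.
rewrite !mulrBr [v * (v * q)]mulrA homog1_sq // mul0r subr0 addrA subrK opprB.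
by rewrite !mulrA (homog1_anticomm hv hw) mulNr opprK addrA addrAC.
Qed.

Lemma contraction_ideal_add I lam v : two_sided_ideal I ->
  ext_homog 1 v -> form_eval lam v = 0 ->
  (forall x, I x -> I (contraction lam x)) ->
  forall x, ideal_add I v x -> ideal_add I v (contraction lam x).
Proof.
move=> iI hv lv Ilam x [y /Ilam]; rewrite linearB /= contraction_homog1 // lv scale0r sub0r => xy.
by exists (- contraction lam y); rewrite mulrN.
Qed.

Lemma regular_mod_add I lam v w : two_sided_ideal I ->
  ext_homog 1 v -> ext_homog 1 w -> form_eval lam v = 1 -> form_eval lam w = 0 ->
  (forall x, I x -> I (contraction lam x)) ->
  regular_mod I w -> regular_mod (ideal_add I v) w.
Proof.
move=> iI hv hw lv lw Ilam wreg x [y wxy]; have [_ ID IM] := iI.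
set D := contraction lam in Ilam *.
have Dv z : D (v * z) = z - v * D z by rewrite /D contraction_homog1 // lv scale1r.
have Dw z : D (w * z) = - (w * D z) by rewrite /D contraction_homog1 // lw scale0r sub0r.
(* [x0] represents [x] modulo [v] and is killed by [D]; the correction in [y0] keeps [w x0 - v y0]
   equal to [w x - v y]. *)
pose x0 := x - v * D x; pose y0 := y + w * D x.
have Dx0 : D x0 = 0.
  by rewrite /x0 /D linearB /= -/D Dv opprB addrCA subrr addr0 /D contraction_sq mulr0.
have xy0 : I (w * x0 - v * y0).
  suff -> : w * x0 - v * y0 = w * x - v * y by [].
  rewrite /x0 /y0 mulrBr mulrDr !mulrA (homog1_anticomm hw hv) mulNr opprK opprD.
  by rewrite addrACA subrr addr0.
(* [D] kills [w x0], so applying it to the relation leaves [v (D y0) - y0] in [I]; multiplying by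
   [- v] removes the first term. *)
have vy0 : I (v * y0).
  have := Ilam _ xy0; rewrite /D linearB /= -/D Dw Dx0 mulr0 oppr0 sub0r Dv => h.
  have := (IM (- v) _ h).1; rewrite mulrN mulNr opprK mulrBr mulrA homog1_sq //.
  by rewrite mul0r subr0.
have /wreg[z xz] : I (w * x0) by rewrite -[w * x0](subrK (v * y0)); apply: ID.
by exists z, (D x); move: xz; rewrite /x0 addrAC.
Qed.

Lemma regular_of_contraction I lam v : two_sided_ideal I ->
  ext_homog 1 v -> form_eval lam v = 1 -> (forall x, I x -> I (contraction lam x)) ->
  regular_mod I v.
Proof.
move=> iI hv lv Ilam x /Ilam; rewrite contraction_homog1 // lv scale1r => h.
by exists (contraction lam x).
Qed.

End Ideals.

(** * Contractions that preserve the Orlik-Solomon ideal *)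

Section OrlikSolomonIdeal.
Variables (K : fieldType) (n : nat) (M : matroid n).
Local Notation E := (exterior K n).
Local Notation r := (matroid_rank M).
Implicit Types (S T X : {set 'I_n}) (x y : E) (lam : 'I_n -> K).
Local Open Scope ring_scope.

Definition os_ideal : E -> Prop :=
  ideal_gen [set boundary K S | S in [set S | dependent M S]]%classic.

Lemma os_idealP : two_sided_ideal os_ideal.
Proof.
split=> [I [[]]//|x y Jx Jy I II|a x Jx]; first by case: (II) => -[_ ID _] _; apply: ID; [apply: Jx|apply: Jy].
by split=> I II; case: (II) => -[_ _ IM] _; have [] := IM a x (Jx I II).
Qed.

Lemma os_ideal_boundary S : dependent M S -> os_ideal (boundary K S).
Proof. by move=> dS I [_]; apply; exists S. Qed.

Lemma os_ideal_min (I : E -> Prop) : two_sided_ideal I ->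
  (forall S, dependent M S -> I (boundary K S)) -> forall x, os_ideal x -> I x.
Proof. by move=> iI IS x; apply; split=> // _ [S dS <-]; apply: IS. Qed.

Definition indicator X : 'I_n -> K := fun i => (i \in X)%:R.

Lemma basis_split S X :
  ext_basis K S = (-1) ^+ inversions (S :&: X) (S :\: X) *:
    (ext_basis K (S :&: X) * ext_basis K (S :\: X)).
Proof.
rewrite ext_basisM (_ : [disjoint _ & _]); last first.
  by rewrite -setI_eq0; apply/eqP/setP => i; rewrite !inE; case: (i \in X); rewrite ?andbF.
by rewrite setID scalerA -exprD addnn -signr_odd odd_double scale1r.
Qed.

(** The contraction by [X] anticommutes with the boundary, acts on [S :&: X] as the boundary and
    kills [S :\: X]. What remains is the boundary of a product whose first factor is itself a
    boundary. *)
Lemma boundary_separator S X : exists c : K,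
  contraction (indicator X) (boundary K S) = c *: (boundary K (S :&: X) * boundary K (S :\: X)).
Proof.
have DX : contraction (indicator X) (ext_basis K (S :&: X)) = boundary K (S :&: X).
  by rewrite contraction_basis; apply: eq_bigr => i; rewrite /indicator inE => /andP[_ ->]; rewrite mul1r.
have DX' : contraction (indicator X) (ext_basis K (S :\: X)) = 0.
  rewrite contraction_basis big1 // => i; rewrite /indicator inE => /andP[/negPf-> _].
  by rewrite mul0r scale0r.
rewrite boundaryE contraction_anticomm {1}(basis_split S X) linearZ /= contractionM DX DX' mulr0 addr0.
rewrite linearZ /= contractionM !boundaryE contraction_sq mul0r add0r parity_contraction parity_basis.
by rewrite mulNr scalerN opprK [contraction _ (_ *: _)]linearZ /= -scalerAl scalerA; eexists.
Qed.

Lemma os_ideal_contraction_separator X x : separator r setT X ->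
  os_ideal x -> os_ideal (contraction (indicator X) x).
Proof.
move=> sX; have iJ := os_idealP; have [J0 JD JM] := iJ.
(* The condition on [parity x] makes this closed under right multiplication, since the contraction
   of [x * a] contains [parity x] times the contraction of [a]. *)
pose I x := [/\ os_ideal x, os_ideal (parity x) & os_ideal (contraction (indicator X) x)].
suff h : forall x, os_ideal x -> I x by case/h.
apply: os_ideal_min => [|S dS].
  split; first by split; rewrite ?linear0.
    by move=> y z [y1 y2 y3] [z1 z2 z3]; split; rewrite ?linearD; apply: JD.
  move=> a y [y1 y2 y3]; split; split; rewrite ?parityM ?contractionM.
  - exact: (JM a _ y1).1.
  - exact: (JM _ _ y2).1.
  - by apply: JD; [exact: (JM _ _ y1).1|exact: (JM _ _ y3).1].
  - exact: (JM a _ y1).2.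
  - exact: (JM _ _ y2).2.
  - by apply: JD; [exact: (JM _ _ y3).2|exact: (JM _ _ y2).2].
split; first exact: os_ideal_boundary.
  rewrite boundaryE parity_contraction parity_basis linearZ /= -scaleNr -boundaryE.
  by apply: (ideal_scale _ iJ); apply: os_ideal_boundary.
have [c ->] := boundary_separator S X; apply: (ideal_scale _ iJ).
(* The rank is additive along [X], so one of the two parts of a dependent set is dependent and its
   boundary is a factor in J. *)
have [dX|dX] : dependent M (S :&: X) \/ dependent M (S :\: X).
  move: dS; rewrite !dependentE (separator_split (matroid_rankP M) sX (subsetT S)) -(cardsID X S).
  by case: (ltnP (r (S :&: X))) => [|h1]; [left|case: (ltnP (r (S :\: X))) => [|h2]; [right|lia]].
- exact: (JM _ _ (os_ideal_boundary dX)).2.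
- exact: (JM _ _ (os_ideal_boundary dX)).1.
Qed.

Lemma os_ideal_contraction lam x :
  (forall i j, j \in component M i -> lam j = lam i) ->
  os_ideal x -> os_ideal (contraction lam x).
Proof.
move=> lamC Jx.
have -> : contraction lam x =
    \sum_(m in component_minima M) lam m *: contraction (indicator (component M m)) x.
  apply/ffunP => S; rewrite ffunE sum_ffunE.
  under [RHS]eq_bigr => m _ do rewrite !ffunE /GRing.scale /= mulr_sumr.
  rewrite exchange_big /=; apply: eq_bigr => k _.
  have [m mR mk] := component_minimaP M k.
  rewrite (bigD1 m) //= big1 ?addr0 => [|m' /andP[m'R neq]].
    by rewrite /indicator mk mem_component mul1r (lamC m k) // mk mem_component.
  rewrite /indicator (_ : k \in _ = false) ?mul0r ?mulr0 //.
  apply: contraNF neq => km'; apply/eqP; apply: (component_inj m'R mR).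
  by rewrite mk (component_eq km').
apply: (ideal_sum os_idealP) => m _; apply: (ideal_scale _ os_idealP).
by apply: os_ideal_contraction_separator => //; apply: component_separator.
Qed.

End OrlikSolomonIdeal.

(** * The broken circuit basis *)

Section NBCBasis.
Variables (K : fieldType) (n : nat) (M : matroid n).
Hypothesis loopM : loopless M.
Local Notation E := (exterior K n).
Local Notation gen := (@ext_gen K n).
Local Notation r := (matroid_rank M).
Implicit Types (R S T X : {set 'I_n}) (i j k c : 'I_n) (s : seq 'I_n) (x y z v w : E).
Local Open Scope ring_scope.

Let rk : rank_function r := matroid_rankP M.

Definition flat_of s : {set 'I_n} := [set i | r (i |: [set j in s]) == r [set j in s]].

Definition block c s : 'I_n -> K := indicator K (flat_of (c :: s) :\: flat_of s).

(* For S = {c_1 < ... < c_p}, the functional of the flag of the flats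
   F_j = flat_of {c_j, ..., c_p}: it contracts with the indicators of the sets
   F_j :\: F_(j+1) and takes the constant term. *)
Fixpoint flag_functional s x : K :=
  if s is c :: s' then flag_functional s' (contraction (block c s') x) else x set0.

Lemma flag_functional_is_linear s : linear_for *%R (flag_functional s).
Proof.
elim: s => [|c s IHs] a x y /=; first by rewrite !ffunE.
by rewrite linearP IHs.
Qed.

HB.instance Definition _ s :=
  GRing.isLinear.Build K E K _ (flag_functional s) (@flag_functional_is_linear s).

Lemma span_self s : {subset s <= flat_of s}.
Proof.
move=> i si; rewrite inE (setUidPr _) // sub1set inE; exact: si.
Qed.

Lemma span_cons c s : flat_of s \subset flat_of (c :: s).
Proof.
apply/subsetP => i; rewrite !inE => /eqP/(closure_mono rk) h; apply/eqP/h.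
by rewrite set_cons subsetUr.
Qed.

Lemma span_idem s T i : T \subset flat_of s -> r (i |: T) = r T -> i \in flat_of s.
Proof.
move=> Ts iT; rewrite inE; apply/eqP; apply: closure_trans iT => // b bT.
by have := subsetP Ts b bT; rewrite inE => /eqP.
Qed.

Fixpoint same_flats s i j : bool :=
  ((i \in flat_of s) == (j \in flat_of s)) && (if s is c :: s' then same_flats s' i j else true).

Lemma same_flats_out s i j : i \notin flat_of s -> j \notin flat_of s -> same_flats s i j.
Proof.
elim: s => [|c s IHs] /= iF jF; rewrite (negPf iF) (negPf jF) //=.
by apply: IHs; [apply: contra iF|apply: contra jF]; apply: (subsetP (span_cons c s)).
Qed.

Lemma indep_add s T : r (T :&: flat_of s) = #|T :&: flat_of s| ->
  {in T :\: flat_of s &, forall i j, i = j} -> r T = #|T|.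
Proof.
move=> rT T1; have [T0|[i iT]] := set_0Vmem (T :\: flat_of s).
  by move: rT; rewrite (setIidPl _) // -setD_eq0 T0.
have TE : T = i |: (T :&: flat_of s).
  apply/setP => j; rewrite !inE; have := iT; rewrite !inE => /andP[iF iTT].
  apply/idP/orP => [jT|[/eqP->//|/andP[]//]].
  have [jF|jF] := boolP (j \in flat_of s); [right|left; apply/eqP/T1 => //].
    by rewrite jT; move: jF; rewrite inE.
  by rewrite inE jF jT.
have iF : i \notin flat_of s by move: iT; rewrite inE => /andP[].
rewrite TE cardsU1 inE (negPf iF) andbF /= -rT.
have := rank_setU1 rk i (T :&: flat_of s); have := rank_mono rk (subsetUr [set i] (T :&: flat_of s)).
have : r (i |: (T :&: flat_of s)) <> r (T :&: flat_of s).
  by move=> h; move: iF; rewrite (span_idem (subsetIr T (flat_of s)) h).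
lia.
Qed.

(** Climbing the flag, each flat contributes at most one new element of [T], and it lies outside the
    previous flat. Contrapositively, every dependent set has two elements that no flat of the flag
    separates. *)
Lemma indep_of_flats s T : {in T &, forall i j, same_flats s i j -> i = j} -> r T = #|T|.
Proof.
move=> Ts; apply: (@indep_add s); last first.
  move=> i j; rewrite !inE => /andP[iF iT] /andP[jF jT].
  by apply: Ts => //; apply: same_flats_out; rewrite inE.
have : {in T :&: flat_of s &, forall i j, same_flats s i j -> i = j}.
  by move=> i j; rewrite !inE => /andP[iT _] /andP[jT _]; apply: Ts.
have : T :&: flat_of s \subset flat_of s by apply: subsetIr.
elim: s (T :&: _) {Ts} => [|c s IHs] U US Uinj.
  (* Without loops the bottom flat is empty. *)
  suff -> : U = set0 by rewrite cards0 (rank_set0 rk).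
  apply/eqP; rewrite -subset0; apply: subset_trans US _; apply/subsetP => i.
  by rewrite !inE set_nil setU0 (rank_set0 rk) loopless_rank.
have Uinj' : {in U &, forall i j, same_flats s i j -> i = j}.
  by move=> i j iU jU h; apply: Uinj => //=; rewrite !(subsetP US) //= eqxx.
apply: (@indep_add s).
  apply: IHs; first exact: subsetIr.
  by move=> i j; rewrite !inE => /andP[iT _] /andP[jT _]; apply: Uinj'.
move=> i j; rewrite !inE => /andP[iF iT] /andP[jF jT].
by apply: Uinj' => //; apply: same_flats_out; rewrite inE.
Qed.

Fixpoint kills s v : Prop :=
  if s is c :: s' then form_eval (block c s') v = 0 /\ kills s' v else True.

Lemma same_flats_span s i j : same_flats s i j -> (i \in flat_of s) = (j \in flat_of s).
Proof. by case: s => [|c s] /= /andP[/eqP]. Qed.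

Lemma same_flats_kills s i j : same_flats s i j -> kills s (gen i - gen j).
Proof.
elim: s => // c s IHs /= /andP[/eqP h1 h2]; split; last exact: IHs.
rewrite addrC -scaleN1r form_eval_linear !form_eval_gen /block /indicator !inE.
by move: h1 (same_flats_span h2); rewrite !inE => -> ->; rewrite mulN1r addNr.
Qed.

Lemma kills_gen s i : i \notin flat_of s -> kills s (gen i).
Proof.
elim: s => // c s IHs /= iF; split; last first.
  by apply: IHs; apply: contra iF; apply: (subsetP (span_cons c s)).
by rewrite form_eval_gen /block /indicator inE (negPf iF) andbF.
Qed.

Lemma flag_functional_kills s v x : ext_homog 1 v -> kills s v ->
  flag_functional s (v * x) = 0.
Proof.
move=> hv; elim: s x => [|c s IHs] x /=.
  move=> _; rewrite [LHS]ffunE big1 // => S; rewrite subset0 => /eqP->.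
  have [->|/hv] := eqVneq (v set0) 0; first by rewrite mul0r mulr0.
  by rewrite cards0.
by case=> vc vs; rewrite contraction_homog1 // vc scale0r sub0r linearN /= IHs // oppr0.
Qed.

(** Up to sign, e_S is [e_i e_j z], and its boundary [e_j z - e_i z + e_i e_j (d z)] equals
    [(e_i - e_j) (e_j (d z) - z)], where [d] denotes the boundary map. *)
Lemma boundary_factor S i j : i \in S -> j \in S -> i != j ->
  exists y, boundary K S = (gen i - gen j) * y.
Proof.
move=> iS jS ij.
have step k T : k \in T -> exists c : K, ext_basis K T = c *: (gen k * ext_basis K (T :\ k)).
  move=> kT; exists ((-1) ^+ inversions [set k] (T :\ k)).
  rewrite /ext_gen ext_basisM disjoints1 setD11 setD1K // scalerA -exprD addnn.
  by rewrite -signr_odd odd_double scale1r.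
have jSi : j \in S :\ i by rewrite !inE eq_sym ij.
have [a Ea] := step i S iS; have [b Eb] := step j _ jSi.
rewrite boundaryE Ea Eb -scalerAr scalerA linearZ /=.
set z := ext_basis K _; exists ((a * b) *: (gen j * contraction (fun=> 1) z - z)).
rewrite -scalerAr !contraction_gen !scale1r; congr (_ *: _).
by rewrite [RHS]mulrBl !mulrBr !mulrA gen_sq mul0r sub0r opprK opprB addrC.
Qed.

Lemma flag_functional_os s x : os_ideal M x -> flag_functional s x = 0.
Proof.
(* Vanishing on all two-sided multiples is required, because only this stronger property defines an
   ideal. *)
move=> Jx; suff h : forall x, os_ideal M x -> forall a b, flag_functional s (a * x * b) = 0.
  by rewrite -[x]mul1r -[_ * x]mulr1 h.
apply: os_ideal_min => [|S dS a b].
  split=> [a b|y z Iy Iz a b|c y Iy].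
  - by rewrite mulr0 mul0r linear0.
  - by rewrite mulrDr mulrDl linearD /= Iy Iz addr0.
  - split=> a b; first by rewrite mulrA Iy.
    by rewrite mulrA -mulrA Iy.
have [i [j [iS jS ij /same_flats_kills kij]]] :
    exists i j, [/\ i \in S, j \in S, i != j & same_flats s i j].
  apply: contrapT => none; move: dS; rewrite dependentE (@indep_of_flats s) ?ltnn //.
  move=> i j iS jS h; apply/eqP; apply: contrapT => /negP ij; apply: none.
  by exists i, j.
have hv : ext_homog 1 (gen i - gen j).
  by rewrite addrC -scaleN1r; apply: homog1_linear; apply: homog1_gen.
have [y ->] := boundary_factor iS jS ij.
by rewrite mulrA (mul_homog1 a hv) -!mulrA flag_functional_kills.
Qed.

(** The consequence of the absence of broken circuits on which the pairing with monomials relies;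
    [nbc_min_chain] supplies it. *)
Fixpoint min_chain s : Prop :=
  if s is c :: s' then
    [/\ forall i, i \in flat_of (c :: s') -> (c <= i)%N, c \notin flat_of s' & min_chain s']
  else True.

(** A monomial with nonzero value must supply one element for each contraction, taken from the
    corresponding flat, whose least element is the entry of [s]. Hence the pairing is triangular for
    the sum of the elements. *)
Lemma flag_functional_basis s T : min_chain s -> flag_functional s (ext_basis K T) != 0 ->
  (\sum_(i <- s) i <= \sum_(i in T) i)%N /\
  ((\sum_(i in T) i <= \sum_(i <- s) i)%N -> T = [set i in s]).
Proof.
elim: s T => [|c s IHs] T /=.
  move=> _; rewrite ffunE; case: (set0 =P T) => [<- _|]; last by rewrite eqxx.
  by rewrite big_nil set_nil.
case=> cmin _ chs; rewrite contraction_basis linear_sum /= => nz.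
have [i iT] : exists2 i, i \in T & flag_functional s
    ((block c s i * (-1) ^+ below T i) *: ext_basis K (T :\ i)) != 0.
  apply: contrapT => none; move: nz; rewrite big1 ?eqxx // => i iT; apply/eqP.
  by apply: contrapT => /negP h; apply: none; exists i.
rewrite linearZ /= !mulf_eq0 !negb_or => /andP[/andP[bi _] /(IHs _ chs)[le1 le2]].
have {bi} iF : i \in flat_of (c :: s).
  by move: bi; rewrite /block /indicator inE; case: (i \in flat_of (c :: s)); rewrite ?andbF ?eqxx.
have ci := cmin i iF; rewrite big_cons (big_setD1 i iT) /=; split; first exact: leq_add.
move=> le3; have {le2}Ti := le2 _; rewrite set_cons -Ti; last first.
  by rewrite -(leq_add2l c); apply: leq_trans le3; rewrite leq_add2r.
have <- : i = c; last by rewrite setD1K.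
apply/val_inj/eqP; rewrite eqn_leq ci andbT /= -(leq_add2r (\sum_(j <- s) j)).
by apply: leq_trans le3; rewrite leq_add2l.
Qed.

Lemma flag_functional_diag s : min_chain s -> flag_functional s (ext_basis K [set i in s]) = 1.
Proof.
elim: s => [|c s IHs] /=; first by rewrite ffunE set_nil eqxx.
case=> cmin cs chs; rewrite contraction_basis linear_sum (bigD1 c) /=; last by rewrite inE mem_head.
rewrite big1 ?addr0.
  have cns : c \notin [set i in s] by rewrite inE; apply: contra cs; apply: span_self.
  rewrite linearZ /= set_cons setU1K // /block /indicator inE cs span_self ?mem_head // mul1r.
  rewrite (_ : below _ c = 0%N) ?mul1r ?IHs //.
  apply/eqP; rewrite cards_eq0; apply/eqP/setP => i; rewrite !inE.
  apply/negP => /andP[ics]; rewrite ltnNge cmin //; apply: span_self.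
  by rewrite inE.
move=> i; rewrite !inE => /andP[/orP[/eqP->|is1]]; first by rewrite eqxx.
by rewrite /block /indicator inE (span_self is1) mul0r scale0r linear0.
Qed.

Lemma nbc_sub S T : T \subset S -> nbc r setT S -> nbc r setT T.
Proof.
move=> TS /andP[_ /forall_inP h]; apply/andP; split; first exact: subsetT.
apply/forall_inP => j /h; apply: contraTT; rewrite -!leqNgt => le.
rewrite (closure_mono rk (A := above j T)) //.
  by apply/subsetP => i; rewrite !inE => /andP[/(subsetP TS)-> ->].
by apply/eqP; rewrite eqn_leq le (rank_mono rk) // subsetUr.
Qed.

Lemma nbc_min_chain s : sorted (fun i j : 'I_n => (i < j)%N) s ->
  nbc r setT [set i in s] -> min_chain s.
Proof.
elim: s => //= c s IHs ps bs; have lt_cs : {in s, forall j, (c < j)%N}.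
  by apply/allP; apply: order_path_min ps => i j k; apply: ltn_trans.
have aboveE : above c [set i in c :: s] = [set i in s].
  apply/setP => i; rewrite !inE; case: (i =P c) => [->|_] /=.
    by rewrite ltnn; apply/esym/negP => /lt_cs; rewrite ltnn.
  by apply/andb_idr/lt_cs.
have /andP[_ /forall_inP h] := bs; split.
- move=> i; rewrite leqNgt inE => /eqP iF; apply/negP => ic.
  have := h i (in_setT i); rewrite (_ : above i _ = [set j in c :: s]) ?iF ?ltnn //.
  apply/setP => j; rewrite !inE; apply/andb_idr => /orP[/eqP->//|/lt_cs].
  exact: ltn_trans.
- by have := h c (in_setT c); rewrite aboveE inE; case: eqP => // ->; rewrite ltnn.
- apply: IHs; first exact: path_sorted ps.
  by apply: nbc_sub bs; rewrite set_cons subsetUr.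
Qed.

Lemma enum_sorted S : sorted (fun i j : 'I_n => (i < j)%N) (enum S).
Proof.
rewrite /enum_mem; apply: sorted_filter => [a b c|]; first exact: ltn_trans.
by have := iota_ltn_sorted 0 n; rewrite -val_enum_ord sorted_map enumT.
Qed.

Lemma nbc_enum S : nbc r setT S -> min_chain (enum S).
Proof.
move=> bS; apply: nbc_min_chain; first exact: enum_sorted.
by rewrite (_ : [set i in enum S] = S) //; apply/setP => i; rewrite inE mem_enum.
Qed.

End NBCBasis.

(** * Linear forms with zero component sums *)

Section EulerCharacteristic.
Variables (K : fieldType) (n : nat) (M : matroid n).
Hypothesis loopM : loopless M.
Local Notation E := (exterior K n).
Local Notation gen := (@ext_gen K n).
Local Notation r := (matroid_rank M).
Local Notation R := (component_minima M).
Implicit Types (S T X : {set 'I_n}) (i j k m : 'I_n) (x y z v w : E) (lam : 'I_n -> K).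
Local Open Scope ring_scope.

Let rk : rank_function r := matroid_rankP M.

Lemma contraction_ideal_adds (I : E -> Prop) lam (vs : seq E) : two_sided_ideal I ->
  (forall v, v \in vs -> ext_homog 1 v) -> (forall v, v \in vs -> form_eval lam v = 0) ->
  (forall x, I x -> I (contraction lam x)) ->
  forall x, ideal_adds I vs x -> ideal_adds I vs (contraction lam x).
Proof.
move=> iI + + Ilam; elim/last_ind: vs => // vs v IHvs hv lv; rewrite ideal_adds_rcons.
have vs_v u : u \in vs -> u \in rcons vs v by rewrite mem_rcons inE => ->; rewrite orbT.
have hvs u : u \in vs -> ext_homog 1 u by move=> /vs_v/hv.
apply: contraction_ideal_add; first exact: ideal_adds_ideal.
- by apply: hv; rewrite mem_rcons mem_head.
- by apply: lv; rewrite mem_rcons mem_head.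
by apply: IHvs => // u /vs_v/lv.
Qed.

Definition rooted_ideal : E -> Prop := ideal_adds (os_ideal M) [seq gen m | m <- enum R].

Local Notation L := rooted_ideal.

Definition rooted_nbc S : bool := nbc r setT S && [disjoint S & R].

Lemma gen_homog1 (l : seq 'I_n) : forall v, v \in map gen l -> ext_homog 1 v.
Proof. by move=> v /mapP[m _ ->]; apply: homog1_gen. Qed.

Lemma rooted_idealP : two_sided_ideal L.
Proof. by apply: ideal_adds_ideal (os_idealP _ _) _; apply: gen_homog1. Qed.

(** By additivity of the rank only the part of [S] in the component of [m] matters. It lies above
    [m], so the condition in [nbc] at [m] applies. *)
Lemma root_notin_span S m : rooted_nbc S -> m \in R -> m \notin flat_of M (enum S).
Proof.
move=> /andP[/andP[_ /forall_inP bS] SR] mR; have := bS m (in_setT m).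
apply: contraTN; rewrite inE -leqNgt (_ : [set j in enum S] = S); last first.
  by apply/setP => i; rewrite inE mem_enum.
have sX := component_separator M m; set X := component M m in sX.
have mX : m \in X by apply: mem_component.
have mS : m \notin S by apply: contraTN SR => mS; apply/pred0Pn; exists m; rewrite /= mS.
rewrite (separator_split rk sX (subsetT (m |: S))) (separator_split rk sX (subsetT S)).
have -> : (m |: S) :&: X = m |: (S :&: X).
  by apply/setP => i; rewrite !inE; case: eqP => [->|//]; rewrite mX.
have -> : (m |: S) :\: X = S :\: X.
  by apply/setP => i; rewrite !inE; case: eqP => [->|//]; rewrite mX.
rewrite eqn_add2r => /eqP h; rewrite (closure_mono rk _ h) //.
apply/subsetP => i; rewrite !inE => /andP[iS iX]; rewrite iS ltn_neqAle /=.
move: mR; rewrite inE => /forall_inP/(_ i iX) ->; rewrite andbT.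
by apply: contraNneq mS => /val_inj ->.
Qed.

Lemma flag_functional_rooted S x : rooted_nbc S -> L x -> flag_functional M (enum S) x = 0.
Proof.
move=> bS; rewrite /rooted_ideal.
have : {subset enum R <= R} by move=> m; rewrite mem_enum.
elim/last_ind: (enum R) x => [|l m IHl] x lR; first exact: flag_functional_os.
rewrite map_rcons ideal_adds_rcons => -[y /IHl].
rewrite linearB /= flag_functional_kills ?subr0; last 2 first.
- exact: homog1_gen.
- by apply/kills_gen/root_notin_span => //; apply: lR; rewrite mem_rcons mem_head.
by apply=> i il; apply: lR; rewrite mem_rcons inE il orbT.
Qed.

Definition supported (P : {set 'I_n} -> Prop) x : Prop := forall S, x S != 0 -> P S.

Lemma supported_lin P (c : K) x y : supported P x -> supported P y -> supported P (c *: x + y).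
Proof.
move=> Px Py S; have [xS|/Px//] := eqVneq (x S) 0; have [yS|/Py//] := eqVneq (y S) 0.
by rewrite !ffunE xS yS scaler0 addr0 eqxx.
Qed.

Lemma supported0 P : supported P 0.
Proof. by move=> S; rewrite ffunE eqxx. Qed.

Lemma supported_sum P (J : finType) (F : J -> E) :
  (forall a, supported P (F a)) -> supported P (\sum_a F a).
Proof.
move=> PF; elim/big_ind: _ => // [|x y Px Py]; first exact: supported0.
by rewrite -[x]scale1r; apply: supported_lin.
Qed.

Lemma rooted_unique x : supported rooted_nbc x -> L x -> x = 0.
Proof.
move=> sx Lx; apply/ffunP => S; rewrite ffunE; apply/eqP; apply: contraTT isT => xS.
pose wt (T : {set 'I_n}) := (\sum_(i in T) i)%N.
(* By triangularity, the functional of a heaviest monomial [T] of [x] vanishes on all other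
   monomials of [x], so its value is the coefficient at [T]. *)
case: (arg_maxnP (P := fun T => x T != 0) wt xS) => T xT maxT.
have := flag_functional_rooted (sx _ xT) Lx.
have cT : min_chain M (enum T) by apply/nbc_enum; case/andP: (sx _ xT).
have ET : [set i in enum T] = T by apply/setP => i; rewrite inE mem_enum.
rewrite [x in flag_functional _ _ x]basis_sum linear_sum (bigD1 T) //= big1 ?addr0.
  rewrite linearZ /=; have := flag_functional_diag K cT; rewrite ET => ->.
  by rewrite mulr1 => x0; rewrite x0 eqxx in xT.
move=> U UT; rewrite linearZ /=; have [->|xU] := eqVneq (x U) 0; first by rewrite mul0r.
have [->|fU] := eqVneq (flag_functional M (enum T) (ext_basis K U)) 0; first by rewrite mulr0.
have [_] := flag_functional_basis cT fU; rewrite ET big_enum => h.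
by case/eqP: UT; apply: h; apply: maxT.
Qed.

(** The normal form keeps track of the degree because the final count separates even from odd
    sets. *)
Definition reducible d x : Prop :=
  exists z, L (x - z) /\ supported (fun S => rooted_nbc S /\ #|S| = d) z.

Lemma reducible_lin d (c : K) x y : reducible d x -> reducible d y -> reducible d (c *: x + y).
Proof.
move=> [s [Ls ss]] [t [Lt st]]; exists (c *: s + t); split; last exact: supported_lin.
rewrite opprD addrACA -scalerBr; apply: (ideal_lin c rooted_idealP) => //.
Qed.

Lemma reducible_ideal d x : L x -> reducible d x.
Proof. by move=> Lx; exists 0; rewrite subr0; split=> //; apply: supported0. Qed.

Lemma reducible_sum d (J : finType) (P : pred J) (F : J -> E) :
  (forall a, P a -> reducible d (F a)) -> reducible d (\sum_(a | P a) F a).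
Proof.
move=> PF; elim/big_ind: _ => // [|x y Px Py]; last by rewrite -[x]scale1r; apply: reducible_lin.
by apply: reducible_ideal; case: rooted_idealP.
Qed.

Lemma reducible_scale d (c : K) x : reducible d x -> reducible d (c *: x).
Proof.
move=> rx; rewrite -[_ *: _]addr0; apply: reducible_lin => //.
by apply: reducible_ideal; case: rooted_idealP.
Qed.

Lemma basis_mul_split S T : T \subset S -> exists c : K,
  ext_basis K S = c *: (ext_basis K (S :\: T) * ext_basis K T).
Proof.
move=> TS; exists ((-1) ^+ inversions (S :\: T) T).
rewrite ext_basisM (_ : [disjoint _ & _]); last first.
  by rewrite -setI_eq0; apply/eqP/setP => i; rewrite !inE; case: (i \in T); rewrite ?andbF.
rewrite scalerA -exprD addnn -signr_odd odd_double scale1r.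
by have := setID S T; rewrite (setIidPr TS) setUC => ->.
Qed.

(** Straightening: if [j] lies in the closure of the set [A] of elements of [T] above it, the
    boundary of [j |: A] rewrites the monomial through monomials in which some [i > j] is replaced
    by [j], so the sum of the elements drops. *)
Lemma basis_reducible T : reducible #|T| (ext_basis K T).
Proof.
pose wt (T : {set 'I_n}) := (\sum_(i in T) i)%N.
have [b] := ubnP (wt T); elim: b T => // b IHb T; rewrite ltnS => wT.
have [iL1 iL2 iL3] := rooted_idealP.
have [dTR|] := boolP [disjoint T & R]; last first.
  case/pred0Pn=> m /andP[/= mT mR]; apply: reducible_ideal.
  have [|c ->] := @basis_mul_split T [set m]; first by rewrite sub1set.
  apply: (ideal_scale _ rooted_idealP); apply: (iL3 _ _ _).1.
  apply: ideal_adds_mem (os_idealP _ _) (@gen_homog1 _) _.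
  by apply: map_f; rewrite mem_enum.
have [bT|] := boolP (nbc r setT T).
  exists (ext_basis K T); rewrite subrr; split=> // S; rewrite ffunE.
  by case: (S =P T) => [->|]; rewrite ?eqxx // /rooted_nbc bT dTR.
rewrite /nbc subsetT /= => /forall_inPn[j _]; rewrite -leqNgt => rj.
set A := above j T in rj *; have AT : A \subset T by apply/subsetP => i; rewrite inE => /andP[].
have jA : j \notin A by rewrite inE ltnn andbF.
have Lb : L (ext_basis K (T :\: A) * boundary K (j |: A)).
  apply: (iL3 _ _ _).1; apply: ideal_adds_sub; apply: os_ideal_boundary.
  rewrite dependentE cardsU1 jA; apply: leq_ltn_trans rj _.
  exact: (rank_le_card rk).
have [c ->] := basis_mul_split AT; apply: reducible_scale.
move: Lb; rewrite boundaryE contraction_basis (big_setU1 _ jA) /= mulrDr.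
rewrite setU1K // mul1r -scalerAr; set s := _ ^+ _; set rest := _ * \sum_(_ in _) _ => Lb.
have s2 : s * s = 1 by rewrite -exprD addnn -signr_odd odd_double.
have -> : ext_basis K (T :\: A) * ext_basis K A =
    s *: (s *: (ext_basis K (T :\: A) * ext_basis K A) + rest) + - s *: rest.
  by rewrite scalerDr scalerA s2 scale1r scaleNr addrK.
apply: reducible_lin; first exact: reducible_ideal.
apply: reducible_scale; rewrite /rest mulr_sumr; apply: reducible_sum => i iA.
rewrite -scalerAr ext_basisM; apply: reducible_scale.
(* If [j] already belongs to [T], the two factors share [j] and the term vanishes. *)
case: ifP => [disj|_]; last by apply: reducible_ideal.
apply: reducible_scale.
have ji : j != i by apply: contraNneq jA => ->.
have iT : i \in T := subsetP AT i iA.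
have jT : j \notin T.
  apply: contraTN disj => jT; apply/pred0Pn; exists j.
  by rewrite /= !inE eqxx ji jT ltnn.
have UE : (T :\: A) :|: ((j |: A) :\ i) = j |: (T :\ i).
  apply/setP => k; rewrite !inE; case: (k =P j) => [->|_] /=; first by rewrite ji orbT.
  by case: (k =P i) => [->|_] /=; move: iA; rewrite !inE ?iT //=; case: (k \in T); case: (j < k)%N => // ->.
rewrite UE; have jTi : j \notin T :\ i by rewrite inE (negPf jT) andbF.
have -> : #|T| = #|j |: T :\ i| by rewrite cardsU1 jTi (cardsD1 i T) iT.
apply: IHb; apply: leq_trans wT; rewrite /wt (big_setU1 _ jTi) (big_setD1 i iT) /= ltn_add2r.
by move: iA; rewrite inE => /andP[].
Qed.

Lemma mul_support v x S : ext_homog 1 v -> (v * x) S != 0 ->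
  exists2 T, x T != 0 & #|S| = #|T|.+1.
Proof.
move=> hv vxS; apply: contrapT => none; move: vxS; rewrite [_ S]ffunE big1 ?eqxx // => T TS.
have [->|vT] := eqVneq (v T) 0; first by rewrite mul0r mulr0.
have [->|xT] := eqVneq (x (S :\: T)) 0; first by rewrite !mulr0.
case: none; exists (S :\: T) => //; have := hv _ vT.
by rewrite -(cardsID T S) (setIidPr TS) => ->.
Qed.

Definition rooted_nbc_of (b : bool) : {set {set 'I_n}} :=
  [set S : {set 'I_n} | rooted_nbc S & odd #|S| == b].

Local Notation N := rooted_nbc_of.

Definition coord_space (A : {set {set 'I_n}}) : {vspace E} :=
  <<map (@ext_basis K n) (enum A)>>%VS.

Lemma mem_coord_space (A : {set {set 'I_n}}) x :
  (x \in coord_space A) <-> supported (fun S => S \in A) x.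
Proof.
split=> [xA|sx].
  pose kill (y : E) : E := [ffun S : {set 'I_n} => if S \in A then 0 else y S].
  have kill_lin : linear kill.
    move=> c y z; apply/ffunP => S; rewrite !ffunE; case: ifP => // _.
    by rewrite scaler0 addr0.
  pose kl := GRing.isLinear.Build K E E _ kill kill_lin.
  pose kf : {linear E -> E} := HB.pack kill kl.
  have : (coord_space A <= lker (linfun kf))%VS.
    apply/span_subvP => y /mapP[S]; rewrite mem_enum => SA ->.
    rewrite memv_ker lfunE /=; apply/eqP/ffunP => T; rewrite !ffunE.
    by case: ifPn => // TA; case: (T =P S) => [TS|//]; rewrite TS SA in TA.
  move/subvP/(_ x xA); rewrite memv_ker lfunE /= => /eqP/ffunP k0 S.
  by have := k0 S; rewrite !ffunE; case: ifP => // _ ->; rewrite eqxx.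
rewrite [x]basis_sum; apply: memv_suml => S _.
have [->|/sx SA] := eqVneq (x S) 0; first by rewrite scale0r mem0v.
by apply/memvZ/memv_span/map_f; rewrite mem_enum.
Qed.

Lemma dim_coord_space (A : {set {set 'I_n}}) : \dim (coord_space A) = #|A|.
Proof.
suff /eqP-> : free (map (@ext_basis K n) (enum A)) by rewrite size_map cardE.
have : uniq (enum A) by apply: enum_uniq.
elim: (enum A) => [|S s IHs] /=; first by rewrite nil_free.
case/andP=> Ss us; rewrite free_cons IHs // andbT.
have -> : <<map (@ext_basis K n) s>>%VS = coord_space [set T in s].
  by apply: eq_span => y; apply/mapP/mapP => -[T Ts ->]; exists T; rewrite // ?mem_enum inE // in Ts *.
apply/negP => /mem_coord_space/(_ S); rewrite ffunE eqxx oner_neq0 inE => /(_ isT).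
by apply/negP.
Qed.

(* Multiplication by w, transported to the coordinate space of the basis of E / L
   and called W, is exact and exchanges even and odd degrees: compare ranks. *)
Lemma card_rooted_nbc w : ext_homog 1 w -> regular_mod L w -> #|N true| = #|N false|.
Proof.
move=> hw wreg; have iL := rooted_idealP; have [L0 LD LM] := iL.
have [nfT nfP] := choice basis_reducible.
pose nf (x : E) : E := \sum_T x T *: nfT T.
have nfL x : L (x - nf x).
  rewrite {1}[x]basis_sum /nf -sumrB; apply: (ideal_sum iL) => T _.
  by rewrite -scalerBr; apply: (ideal_scale _ iL); case: (nfP T).
have nf_supp x (P : nat -> Prop) : supported (fun S => P #|S|) x ->
    supported (fun S => rooted_nbc S /\ P #|S|) (nf x).
  move=> Px; apply: supported_sum => T S; rewrite !ffunE.
  have [->|/Px PT] := eqVneq (x T) 0; first by rewrite scale0r eqxx.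
  rewrite mulf_eq0 negb_or => /andP[_ /(nfP T).2[bS ->]].
  by split.
have nf_rooted x : supported rooted_nbc (nf x).
  by move=> S /(@nf_supp x (fun=> True) (fun _ _ => I))[].
have nfE x z : supported rooted_nbc z -> L (x - z) -> nf x = z.
  move=> sz xz; apply/eqP; rewrite -subr_eq0; apply/eqP/rooted_unique.
    by rewrite addrC -scaleN1r; apply: supported_lin.
  have -> : nf x - z = (x - z) - (x - nf x) by rewrite opprB [RHS]addrC addrA subrK.
  exact: idealB.
pose W (z : E) : E := nf (w * z).
have W_lin : linear W.
  move=> c y z; rewrite /W /nf scaler_sumr -big_split; apply: eq_bigr => T _ /=.
  by rewrite mulrDr -scalerAr !ffunE scalerDl scalerA.
pose Wl := GRing.isLinear.Build K E E _ W W_lin.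
pose Wf : {linear E -> E} := HB.pack W Wl.
pose f := linfun Wf.
have fE z : f z = W z by rewrite /f lfunE.
pose U b := coord_space (N b).
have UP b x : (x \in U b) <-> supported (fun S => rooted_nbc S /\ odd #|S| = b) x.
  rewrite mem_coord_space; split=> sx S /sx; rewrite inE; first by case/andP=> ? /eqP.
  by case=> -> ->; rewrite eqxx.
have W_U b z : z \in U b -> W z \in U (~~ b).
  move/UP=> sz; apply/UP; apply: (nf_supp _ (fun d => odd d = ~~ b)) => S /(mul_support hw)[T xT ->].
  by have [_ /=->] := sz _ xT.
have img b : (f @: U b = U (~~ b) :&: lker f)%VS.
  apply: subv_anti; apply/andP; split; apply/subvP => z.
    case/memv_imgP=> y yU ->; rewrite memv_cap memv_ker !fE W_U //=; apply/eqP.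
    rewrite /W; apply: nfE; first exact: supported0.
    have -> : w * nf (w * y) - 0 = - (w * (w * y - nf (w * y))).
      by rewrite subr0 mulrBr mulrA homog1_sq // mul0r sub0r opprK.
    by rewrite -mulNr; apply: (LM _ _ (nfL _)).1.
  rewrite memv_cap memv_ker fE => /andP[zU /eqP Wz].
  have /wreg[y zy] : L (w * z) by have := nfL (w * z); rewrite -/(W z) Wz subr0.
  have sz : supported rooted_nbc z by move=> S nz; have [] := (UP _ _).1 zU S nz.
  (* The preimage given by regularity may mix parities. Its part of parity [~~ b] is mapped into
     [U b], which meets [U (~~ b)] only in 0, so it contributes nothing to [z]. *)
  pose part c : E := [ffun S : {set 'I_n} => if odd #|S| == c then nf y S else 0].
  have partU c : part c \in U c.
    apply/UP => S; rewrite ffunE; case: (odd #|S| =P c) => [<- /nf_rooted //|_].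
    by rewrite eqxx.
  have yE : nf y = part b + part (~~ b).
    by apply/ffunP => S; rewrite !ffunE; case: (odd _); case: (b); rewrite ?addr0 ?add0r.
  have zE : z = W (part b) + W (part (~~ b)).
    rewrite -[W _]scale1r -W_lin scale1r -yE /W; apply/esym/nfE => //.
    have -> : w * nf y - z = - (z - w * y) - w * (y - nf y).
      by rewrite opprB mulrBr opprB [RHS]addrC addrA subrK.
    apply: idealB => //; last by apply: (LM _ _ (nfL _)).1.
    by rewrite -scaleN1r; apply: (ideal_scale _ iL).
  suff zW : z = W (part b) by rewrite zW -fE; apply: memv_img.
  have U1 : z - W (part b) \in U (~~ b) by rewrite memvB // W_U.
  have U2 : z - W (part b) \in U b by rewrite {1}zE addrC addKr -{2}[b]negbK W_U.
  apply/eqP; rewrite -subr_eq0; apply/eqP/ffunP => S; rewrite [RHS]ffunE; apply/eqP.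
  apply: contraTT isT => nz; have [_ o1] := (UP _ _).1 U1 _ nz.
  by have [_ o2] := (UP _ _).1 U2 _ nz; move: o1; rewrite o2; case: (b).
(* By exactness the kernel on each part is the image of the other, so rank-nullity makes both
   dimensions equal to the sum of the two image dimensions. *)
have := limg_ker_dim f (U true); have := limg_ker_dim f (U false).
have := img true; have := img false; rewrite /= => <- <-.
by rewrite !dim_coord_space addnC => -> ->.
Qed.

Lemma nbc_sum_rooted : nbc_sum r setT R = #|N false|%:R - #|N true|%:R.
Proof.
rewrite /nbc_sum (bigID (fun S : {set 'I_n} => ~~ odd #|S|)) /=; congr (_ + _).
  rewrite -sum1_card natr_sum; apply: eq_big => [S|S]; first by rewrite inE eqbF_neg.
  by case/andP=> _ /negPf oS; rewrite -signr_odd oS.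
rewrite -sum1_card natr_sum -sumrN; apply: eq_big => [S|S]; first by rewrite inE negbK eqb_id.
by rewrite negbK => /andP[_ oS]; rewrite -signr_odd oS.
Qed.

Lemma rooted_not_regular w : ext_homog 1 w -> ~ regular_mod L w.
Proof.
move=> hw /(card_rooted_nbc hw) eqN.
have := nbc_sum_gt0 rk (subsetT R) (component_minima_separator (M := M))
  (component_minima_meets (M := M)) (fun i _ => loopless_rank i loopM).
by rewrite nbc_sum_rooted eqN subrr mulr0 Order.POrderTheory.ltxx.
Qed.

(** The generators e_m are adjoined one at a time: the indicator of the component of [m] takes the
    value 1 on e_m and 0 on [w] and on the generators already adjoined. *)
Lemma resonant_not_regular w : ext_homog 1 w ->
  (forall m, m \in R -> form_eval (indicator K (component M m)) w = 0) ->
  ~ regular_mod (os_ideal M) w.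
Proof.
move=> hw w0 wreg; apply: (rooted_not_regular hw); rewrite /rooted_ideal.
have : {subset enum R <= R} by move=> m; rewrite mem_enum.
have := enum_uniq R; elim/last_ind: (enum R) => // l m IHl; rewrite rcons_uniq => /andP[ml ul] lR.
rewrite map_rcons ideal_adds_rcons; have mR : m \in R by apply: lR; rewrite mem_rcons mem_head.
have lR' : {subset l <= R} by move=> i il; apply: lR; rewrite mem_rcons inE il orbT.
apply: (regular_mod_add (lam := indicator K (component M m))) => //.
- by apply: ideal_adds_ideal (os_idealP _ _) _; apply: gen_homog1.
- exact: homog1_gen.
- by rewrite form_eval_gen /indicator mem_component.
- exact: w0.
- apply: contraction_ideal_adds (os_idealP _ _) (@gen_homog1 _) _ _.
    move=> _ /mapP[i il ->]; rewrite form_eval_gen /indicator.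
    rewrite (_ : i \in _ = false) //; apply: contraNF ml => im.
    by rewrite -(component_inj (lR' _ il) mR (component_eq im)).
  move=> x; apply: os_ideal_contraction_separator; exact: component_separator.
- exact: IHl.
Qed.

End EulerCharacteristic.

(** * Regular sequences on the Orlik-Solomon algebra *)

Section RegularSequences.
Variables (K : fieldType) (n : nat) (M : matroid n).
Hypothesis loopM : loopless M.
Local Notation E := (exterior K n).
Local Notation gen := (@ext_gen K n).
Local Notation R := (component_minima M).
Local Notation J := (@os_ideal K n M).
Implicit Types (i j m : 'I_n) (x y z v w : E) (vs : seq E) (lam : 'I_n -> K).
Local Open Scope ring_scope.

Definition quot_proj vs x : quot_seq (OS_algebra M K) vs :=
  quotmod_proj _ (quotmod_proj (OS_ideal M K) x).

Lemma quotmod_proj_eq0 (A : nzRingType) (N : lmodType A) (U : submodule N) (x : N) :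
  (quotmod_proj U x == 0) = (x \in U).
Proof.
have p0 : quotmod_proj U 0 = 0.
  by apply: (addrI (quotmod_proj U 0)); rewrite -quotmod_projD !addr0.
by rewrite -p0 quotmod_projE subr0.
Qed.

Lemma os_proj_eq0 x : quotmod_proj (OS_ideal M K) x = 0 <-> J x.
Proof.
by split=> [/eqP|Jx]; [|apply/eqP]; rewrite quotmod_proj_eq0; [move/asboolP|apply/asboolP].
Qed.

Lemma os_proj_scale a x :
  a *: quotmod_proj (OS_ideal M K) x = quotmod_proj (OS_ideal M K) (a * x).
Proof. exact: quotmod_projZ. Qed.

Lemma os_proj_surj (q : OS_algebra M K) : exists x, quotmod_proj (OS_ideal M K) x = q.
Proof. by have [x <-] := quotmod_proj_surj q; exists x. Qed.

Lemma quot_proj_scale vs a x : a *: quot_proj vs x = quot_proj vs (a * x).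
Proof. by rewrite /quot_proj -os_proj_scale; apply: quotmod_projZ. Qed.

Lemma quot_proj_surj vs (q : quot_seq (OS_algebra M K) vs) : exists x, quot_proj vs x = q.
Proof.
have [p <-] := quotmod_proj_surj q; have [x <-] := quotmod_proj_surj p; by exists x.
Qed.

Lemma quot_projB vs x y : quot_proj vs (x - y) = quot_proj vs x - quot_proj vs y.
Proof.
have -> : quot_proj vs x = quot_proj vs (x - y) + quot_proj vs y.
  by rewrite /quot_proj -!quotmod_projD subrK.
by rewrite addrK.
Qed.

Lemma quot_proj_eq0 vs x : (forall v, v \in vs -> ext_homog 1 v) ->
  quot_proj vs x = 0 <-> ideal_adds J vs x.
Proof.
move=> hv; have iJ := os_idealP K M; have iI := ideal_adds_ideal iJ hv.
have [I0 ID IM] := iI.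
have congr_mod y z : quotmod_proj (OS_ideal M K) y = quotmod_proj (OS_ideal M K) z ->
    ideal_adds J vs z -> ideal_adds J vs y.
  move=> /eqP; rewrite quotmod_projE -quotmod_proj_eq0 => /eqP/os_proj_eq0 yz Iz.
  by have := ID _ _ (ideal_adds_sub vs yz) Iz; rewrite subrK.
rewrite (rwP eqP) quotmod_proj_eq0; split.
  move/asboolP => h.
  (* [ideal_smul] is a smallest submodule, so it suffices to test it against the submodule of the
     classes all of whose representatives lie in the ideal. *)
  pose U := (fun q : OS_algebra M K =>
    forall y, quotmod_proj (OS_ideal M K) y = q -> ideal_adds J vs y).
  apply: (h U _ x (erefl _)); split.
    split=> [y /os_proj_eq0/ideal_adds_sub|p q Up Uq y yE|a q Uq y yE]; first exact.
      have [p' p'E] := os_proj_surj p; have [q' q'E] := os_proj_surj q.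
      have Ipq := ID _ _ (Up _ p'E) (Uq _ q'E).
      apply: (congr_mod _ _ _ Ipq); by rewrite yE quotmod_projD p'E q'E.
    have [q' q'E] := os_proj_surj q.
    apply: (congr_mod _ _ _ (IM a _ (Uq _ q'E)).1); by rewrite yE -os_proj_scale q'E.
  move=> q [a [p [Ia ->]]] y yE; have [p' p'E] := os_proj_surj p.
  have Ia' : ideal_adds J vs a by apply: Ia; split=> //= v; exact: ideal_adds_mem.
  apply: (congr_mod _ _ _ (IM p' _ Ia').2); by rewrite yE -os_proj_scale p'E.
have : {subset vs <= vs} by [].
suff h us : {subset us <= vs} -> forall y, ideal_adds J us y ->
    quotmod_proj (OS_ideal M K) y \in
      ideal_smul (OS_algebra M K) (ideal_gen [set v | v \in vs]%classic).
  by move=> /h; apply.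
elim/last_ind: us => [|us u IHus] uvs y.
  by move/os_proj_eq0 => ->; apply: rpred0.
rewrite ideal_adds_rcons => -[z yz].
rewrite -[y](subrK (u * z)) quotmod_projD rpredD //.
  by apply: IHus => // v vus; apply: uvs; rewrite mem_rcons inE vus orbT.
apply/asboolP => U [sU]; apply; exists u, (quotmod_proj (OS_ideal M K) z); split.
  by move=> I [_]; apply; apply: uvs; rewrite mem_rcons mem_head.
by rewrite os_proj_scale.
Qed.

Lemma regular_eltE vs v : (forall u, u \in vs -> ext_homog 1 u) -> ext_homog 1 v ->
  regular_elt (quot_seq (OS_algebra M K) vs) v <-> regular_mod (ideal_adds J vs) v.
Proof.
move=> hvs hv; have eq0 := quot_proj_eq0 _ hvs; split=> [reg x /eq0 vx|reg].
  have : [set q : quot_seq (OS_algebra M K) vs | v *: q = 0]%classic (quot_proj vs x).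
    by rewrite /= quot_proj_scale.
  rewrite reg => -[q _ /= qE]; have [y yE] := quot_proj_surj q; exists y; apply/eq0.
  by rewrite quot_projB -quot_proj_scale yE qE subrr.
apply/seteqP; split=> q /=.
  have [x <-] := quot_proj_surj q; rewrite quot_proj_scale => /eq0/reg[y /eq0 yE].
  exists (quot_proj vs y) => //; rewrite quot_proj_scale; apply/eqP.
  by rewrite eq_sym -subr_eq0 -quot_projB yE.
by case=> p _ <-; rewrite scalerA homog1_sq // scale0r.
Qed.

(** The functional of the empty flag is the constant coefficient; it vanishes on J and on multiples
    of elements of degree one. *)
Lemma ideal_adds_proper vs : (forall v, v \in vs -> ext_homog 1 v) -> ~ ideal_adds J vs 1.
Proof.
move=> hv; suff h x : ideal_adds J vs x -> flag_functional M [::] x = 0.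
  by move/h/eqP; rewrite /= ffunE eqxx oner_eq0.
elim/last_ind: vs hv x => [|vs v IHvs] hv x; first exact: flag_functional_os.
rewrite ideal_adds_rcons => -[y /IHvs]; rewrite linearB /=.
have := @flag_functional_kills K n M [::] v y; rewrite /= => -> //.
  by rewrite subr0; apply=> u uvs; apply: hv; rewrite mem_rcons inE uvs orbT.
by apply: hv; rewrite mem_rcons mem_head.
Qed.

Definition homog1_seq vs := forall v, v \in vs -> ext_homog 1 v.

Lemma regular_seqE vs : regular_seq (OS_algebra M K) vs <->
  homog1_seq vs /\
  forall i : nat, (i < size vs)%N -> regular_mod (ideal_adds J (take i vs)) vs`_i.
Proof.
have ht (i : nat) : homog1_seq vs -> homog1_seq (take i vs).
  by move=> hv v /mem_take/hv.
split=> [[hv reg _]|[hv reg]].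
  by split=> // i lti; apply/(regular_eltE (ht i hv) (hv _ (mem_nth 0 lti))); exact: reg.
split=> // [i lti|].
  by apply/(regular_eltE (ht i hv) (hv _ (mem_nth 0 lti))); exact: reg.
by exists (quot_proj vs 1); apply/eqP => /(quot_proj_eq0 _ hv); apply: ideal_adds_proper.
Qed.

Lemma homog1_seq_rcons vs v : homog1_seq (rcons vs v) <-> homog1_seq vs /\ ext_homog 1 v.
Proof.
split=> [h|[h hv] u]; last by rewrite mem_rcons inE => /orP[/eqP->|/h].
by split=> [u uvs|]; apply: h; rewrite mem_rcons inE ?eqxx ?uvs ?orbT.
Qed.

Lemma regular_seq_rcons vs v : regular_seq (OS_algebra M K) (rcons vs v) <->
  [/\ regular_seq (OS_algebra M K) vs, ext_homog 1 v & regular_mod (ideal_adds J vs) v].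
Proof.
split=> [/regular_seqE[/homog1_seq_rcons[hvs hv]]|[/regular_seqE[hvs reg] hv vreg]].
  rewrite size_rcons => reg; split=> //; last first.
    by have := reg _ (ltnSn _); rewrite nth_rcons ltnn eqxx -cats1 take_size_cat.
  apply/regular_seqE; split=> // i lti; have := reg i (ltnW lti).
  by rewrite nth_rcons lti -cats1 takel_cat // ltnW.
apply/regular_seqE; split; first exact/homog1_seq_rcons.
move=> i; rewrite size_rcons ltnS leq_eqVlt => /orP[/eqP->|lti].
  by rewrite nth_rcons ltnn eqxx -cats1 take_size_cat.
by rewrite nth_rcons lti -cats1 takel_cat ?(ltnW lti) //; apply: reg.
Qed.

Lemma regular_seq_nil : regular_seq (OS_algebra M K) [::].
Proof. by apply/regular_seqE. Qed.

Lemma regular_seq_homog1 vs : regular_seq (OS_algebra M K) vs -> homog1_seq vs.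
Proof. by case. Qed.

Lemma regular_seq_descend vs w : ext_homog 1 w -> regular_seq (OS_algebra M K) vs ->
  regular_mod (ideal_adds J vs) w -> regular_mod J w.
Proof.
move=> hw; elim/last_ind: vs => // vs v IHvs /regular_seq_rcons[rvs hv vreg].
rewrite ideal_adds_rcons => wreg; apply: IHvs => //.
apply: regular_mod_descend vreg wreg => //.
by apply: ideal_adds_ideal (os_idealP _ _) _; apply: regular_seq_homog1.
Qed.

Definition component_sums v : 'rV[K]_#|R| :=
  \row_(j < #|R|) form_eval (indicator K (component M (enum_val j))) v.

Local Notation phi := component_sums.

Lemma component_sums_is_linear : linear phi.
Proof. by move=> a x y; apply/rowP => j; rewrite !mxE form_eval_linear. Qed.

HB.instance Definition _ := GRing.isLinear.Build K E 'rV[K]_#|R| _ phi component_sums_is_linear.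

Lemma component_sums_gen i j : j \in component M i -> phi (gen j) = phi (gen i).
Proof.
move=> ji; apply/rowP => l; rewrite !mxE !form_eval_gen /indicator.
by rewrite component_sym (component_eq ji) component_sym.
Qed.

Lemma component_sums_surj (u : 'rV[K]_#|R|) : exists2 v, ext_homog 1 v & phi v = u.
Proof.
exists (\sum_j u 0 j *: gen (enum_val j)).
  apply: homog1_sum => j; rewrite -[_ *: _]addr0; apply: homog1_linear.
    exact: homog1_gen.
  by move=> S; rewrite ffunE eqxx.
rewrite linear_sum; apply/rowP => l; rewrite summxE (bigD1 l) //= big1 ?addr0.
  by rewrite linearZ !mxE form_eval_gen /indicator mem_component mulr1.
move=> j jl; rewrite linearZ !mxE form_eval_gen /indicator (_ : _ \in _ = false) ?mulr0 //.
apply: contraNF jl => h; apply/eqP/enum_val_inj.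
by apply: (component_inj (enum_valP j) (enum_valP l)); apply: component_eq.
Qed.

Lemma component_sums0 w m : phi w = 0 -> m \in R -> form_eval (indicator K (component M m)) w = 0.
Proof.
move=> w0 mR; have := congr1 (fun A : 'rV_#|R| => A 0 (enum_rank_in mR m)) w0.
by rewrite !mxE enum_rankK_in.
Qed.

(* A linear form on the space of component sums that maps v to 1 and vs to 0
   gives a contraction that preserves J + (vs). *)
Lemma free_regular vs v : homog1_seq vs -> ext_homog 1 v -> free (map phi (v :: vs)) ->
  regular_mod (ideal_adds J vs) v.
Proof.
move=> hvs hv freeX; pose X := in_tuple (map phi (v :: vs)).
pose psi := coord X ord0; pose lam i := psi (phi (gen i)).
have lamE w : ext_homog 1 w -> form_eval lam w = psi (phi w).
  move=> hw; rewrite /form_eval /psi [in RHS](homog1E hw) !linear_sum /=; apply: eq_bigr => i _.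
  by rewrite !linearZ /= mulrC.
have psiX (l : 'I_(size (map phi (v :: vs)))) : psi X`_l = (l == ord0)%:R.
  by rewrite /psi coord_free // eq_sym.
have lv : form_eval lam v = 1 by rewrite lamE //; have := psiX ord0; rewrite eqxx.
have lvs u : u \in vs -> form_eval lam u = 0.
  move=> uvs; rewrite (lamE _ (hvs _ uvs)).
  have lt_i : ((index u vs).+1 < size (map phi (v :: vs)))%N by rewrite size_map ltnS index_mem.
  by have := psiX (Ordinal lt_i); rewrite /= (nth_map 0) ?index_mem // nth_index.
have iJ := os_idealP K M.
apply: (regular_of_contraction (ideal_adds_ideal iJ hvs) hv lv).
apply: contraction_ideal_adds => // x; apply: os_ideal_contraction => i j ji.
by rewrite /lam (component_sums_gen ji).
Qed.

(** Otherwise some combination [y] of [vs] has the same component sums as [v]. Then [v - y] is still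
    regular modulo [vs], hence regular on E/J by descent, although its component sums vanish. *)
Lemma regular_notin_span vs v : regular_seq (OS_algebra M K) vs -> ext_homog 1 v ->
  regular_mod (ideal_adds J vs) v -> phi v \notin <<map phi vs>>%VS.
Proof.
move=> rvs hv vreg; apply/negP => phiv; have hvs := regular_seq_homog1 rvs.
have iI := ideal_adds_ideal (os_idealP K M) hvs; have [I0 ID IM] := iI.
pose X := in_tuple (map phi vs).
pose y := \sum_(l < size (map phi vs)) coord X l (phi v) *: vs`_l.
have hl (l : 'I_(size (map phi vs))) : vs`_l \in vs.
  by apply: mem_nth; rewrite -(size_map phi) ltn_ord.
have hy : ext_homog 1 y.
  apply: homog1_sum => l; rewrite -[_ *: _]addr0; apply: homog1_linear.
    exact/hvs/hl.
  by move=> S; rewrite ffunE eqxx.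
have Iy : ideal_adds J vs y.
  apply: (ideal_sum iI) => l _; apply: (ideal_scale _ iI).
  exact: ideal_adds_mem (os_idealP K M) hvs (hl l).
have phiy : phi y = phi v.
  rewrite [RHS](coord_span (X := X) phiv) linear_sum; apply: eq_bigr => l _.
  by rewrite linearZ /= (nth_map 0) // -(size_map phi) ltn_ord.
have hw : ext_homog 1 (v - y) by rewrite addrC -scaleN1r; apply: homog1_linear.
apply: (resonant_not_regular loopM hw).
  by move=> m; apply: component_sums0; rewrite linearB /= phiy subrr.
apply: (regular_seq_descend hw rvs) => x wx.
have /vreg[z xz] : ideal_adds J vs (v * x).
  by rewrite -[v](subrK y) mulrDl; apply: ID => //; apply: (IM _ _ Iy).2.
exists z; rewrite mulrBl opprB addrCA addrC; apply: ID => //.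
exact: (IM _ _ Iy).2.
Qed.

Lemma free_rcons (vT : vectType K) (X : seq vT) u :
  free (rcons X u) = (u \notin <<X>>%VS) && free X.
Proof. by rewrite -free_cons; apply: perm_free; rewrite perm_rcons. Qed.

Lemma regular_seq_free vs : regular_seq (OS_algebra M K) vs -> free (map phi vs).
Proof.
elim/last_ind: vs => [|vs v IHvs]; first by rewrite nil_free.
move=> /regular_seq_rcons[rvs hv vreg]; rewrite map_rcons free_rcons IHvs // andbT.
exact: regular_notin_span.
Qed.

Lemma dim_component_sums : \dim {:'rV[K]_#|R|} = #|R|.
Proof. by rewrite dimvf; apply: mul1n. Qed.

Lemma regular_seq_size vs : regular_seq (OS_algebra M K) vs -> (size vs <= #|R|)%N.
Proof.
move/regular_seq_free => /eqnP; rewrite size_map => <-.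
by apply: leq_trans (dimvS (subvf _)) _; rewrite dim_component_sums.
Qed.

Lemma regular_seq_extend vs : regular_seq (OS_algebra M K) vs -> (size vs < #|R|)%N ->
  exists v, regular_seq (OS_algebra M K) (rcons vs v).
Proof.
move=> rvs lt_vs; have fvs := regular_seq_free rvs.
have /subvPn[u _ uvs] : ~~ (fullv <= <<map phi vs>>)%VS.
  apply: contraL lt_vs => /dimvS; rewrite dim_component_sums -leqNgt.
  by move/leq_trans; apply; rewrite (leq_trans (dim_span _)) // size_map.
have [v hv phiv] := component_sums_surj u; exists v; apply/regular_seq_rcons; split=> //.
apply: free_regular => //; first exact: regular_seq_homog1.
by rewrite /= free_cons phiv uvs.
Qed.

End RegularSequences.

Theorem theorem6p5 (K : fieldType) (n k : nat) (M : matroid n) :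
  infinite_set [set: K]%classic ->
  loopless M ->
  #|connected_components M| = k ->
  has_depth (OS_algebra M K) k.
Proof.
move=> _ loopM <-; rewrite card_connected_components.
have [vs rvs size_vs] : exists2 vs, regular_seq (OS_algebra M K) vs &
    size vs = #|component_minima M|.
  have : (#|component_minima M| <= #|component_minima M|)%N by [].
  elim: {1 3}#|component_minima M| => [_|d IHd ltd].
    by exists [::] => //; apply: regular_seq_nil.
  have [vs rvs svs] := IHd (ltnW ltd).
  have [|v rv] := regular_seq_extend loopM rvs; first by rewrite svs.
  by exists (rcons vs v); rewrite ?size_rcons ?svs.
(* The size bound makes the sequence of full length maximal, and extendability excludes shorter
   maximal sequences. *)
split.
  exists vs; split=> // v /(regular_seq_size loopM).
  by rewrite size_rcons size_vs ltnn.
move=> us [rus maxus]; apply/eqP; rewrite eqn_leq (regular_seq_size loopM rus) /= leqNgt.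
by apply/negP => /(regular_seq_extend loopM rus)[v]; apply: maxus.
Qed.
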